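(* Let $E$ be a directed graph, $K$ a field and $c$ a cycle without exits in $E$ based at a vertex $v$. Then $\mathrm{Ind}_{c^\infty}(K(\mathcal G_E)_{c^\infty})\cong_{gr}N_{vc}$ as graded simple $L_K(E)$-modules.
   Context: $E=(E^0,E^1,s,r)$ is a directed graph of arbitrary cardinality. A vertex is singular if it emits no edges or infinitely many. Finite paths $\mu=e_1\cdots e_n$ ($r(e_i)=s(e_{i+1})$) have length $|\mu|=n$, source $s(e_1)$ and range $r(e_n)$; vertices are paths of length $0$; $F(E)$ is the set of finite paths, $E^\infty$ the set of infinite paths, $\partial E=E^\infty\cup\{\mu\in F(E): r(\mu)\text{ singular}\}$. For $x,y\in\partial E$, $x\sim_ky$ means $x=\mu p$, $y=\nu p$ with $\mu,\nu\in F(E)$, $p\in\partial E$, $r(\mu)=r(\nu)=s(p)$, $|\mu|-|\nu|=k$. A cycle is a path of positive length with equal source and range not passing through any of its vertices twice; an exit for $e_1\cdots e_n$ is an edge $e$ with $s(e)=s(e_i)$ for some $i$ but $e\ne e_i$; $c^\infty=ccc\cdots$. $L_K(E)$ is the Leavitt path algebra: $K$-algebra generated by $\{v,e,e^*\mid v\in E^0,e\in E^1\}$ with relations $vw=\delta_{v,w}v$; $s(e)e=e=er(e)$; $r(e)e^*=e^*=e^*s(e)$; $e^*f=\delta_{e,f}r(e)$; $v=\sum_{s(e)=v}ee^*$ for non-singular $v$. It is spanned by $\mu\nu^*$ ($r(\mu)=r(\nu)$), $\mathbb Z$-graded with $\mu\nu^*$ of degree $|\mu|-|\nu|$. Graded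 simple means nonzero with no proper nonzero graded submodules; $\cong_{gr}$ means isomorphism preserving degrees. $N_{vc}$ is the $K$-vector space whose basis is the set of (distinct) elements $\{\mu\nu^*\mid\mu,\nu\in F(E),\ r(\mu)=r(\nu),\ s(\nu)=v\}$ of $L_K(E)$, with $\mu\nu^*$ homogeneous of degree $|\mu|-|\nu|$ and $L_K(E)$ acting by left multiplication; that is, $N_{vc}=L_K(E)v$ as a graded left $L_K(E)$-module. $\mathcal G_E=\{(x,k,y)\in\partial E\times\mathbb Z\times\partial E:x\sim_ky\}$ is the graph groupoid with $(x,k,y)(y,l,z)=(x,k+l,z)$, $(x,k,y)^{-1}=(y,-k,x)$, $d(x,k,y)=y$, $c(x,k,y)=x$ (units $(x,0,x)$ identified with $x$), degree $(x,k,y)\mapsto k$. The isotropy group at $x$ is $(\mathcal G_E)_x=\{(x,k,x)\in\mathcal G_E\}$; its group algebra is graded with $(x,k,x)$ in degree $k$. $KL_x$ is the $K$-space with basis $L_x=\{(y,k,x)\in\mathcal G_E\}$, right $(\mathcal G_E)_x$-action by composition, left $L_K(E)$-action $\mu\nu^*(y,k,x)=(\mu p,|\mu|-|\nu|+k,x)$ if $y=\nu p$, $0$ otherwise, and $(y,k,x)$ in degree $k$. $\mathrm{Ind}_x(N)=KL_x\otimes_{K(\mathcal G_E)_x}N$ with the total grading; here $N=K(\mathcal G_E)_{c^\infty}$ is the regular module. *)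

(* Defs.v *)
From HB Require Import structures.
From mathcomp Require Import all_boot all_order all_algebra finmap.
From mathcomp Require Import boolp classical_sets cardinality fsbigop.
From mathcomp Require Import generic_quotient monalg.

Set Implicit Arguments.
Unset Strict Implicit.
Unset Printing Implicit Defensive.

Import GRing.Theory.
Local Open Scope quotient_scope.
Local Open Scope ring_scope.

Section Subspace.
Variables (K : fieldType) (V : lmodType K).

Definition subspace (W : V -> Prop) : Prop :=
  W 0 /\ forall a x y, W x -> W y -> W (a *: x + y).

Inductive lspan (S : V -> Prop) : V -> Prop :=
| span_gen x : S x -> lspan S x
| span_zero : lspan S 0
| span_lin a x y : lspan S x -> lspan S y -> lspan S (a *: x + y).

Lemma span_subspace (S : V -> Prop) : subspace (lspan S).
Proof. by split; [exact: span_zero | exact: span_lin]. Qed.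

Lemma span_sub (S W : V -> Prop) :
  subspace W -> (forall x, S x -> W x) -> forall x, lspan S x -> W x.
Proof.
move=> [W0 Wlin] SW x; elim=> [y /SW //|//|a y z _ Wy _ Wz]; exact: Wlin.
Qed.

Record subspaceOf := SubspaceOf {
  sub_pred :> V -> Prop;
  sub_predP : subspace sub_pred }.

Definition spanOf (S : V -> Prop) := SubspaceOf (span_subspace S).

End Subspace.

Section SubspaceTheory.
Variables (K : fieldType) (V : lmodType K) (W : subspaceOf V).

Lemma sub0P : W 0. Proof. exact: (sub_predP W).1. Qed.
Lemma sub_linP a x y : W x -> W y -> W (a *: x + y).
Proof. exact: (sub_predP W).2. Qed.
Lemma subZP a x : W x -> W (a *: x).
Proof. by move=> Wx; rewrite -[_ *: _]addr0; apply: sub_linP => //; exact: sub0P. Qed.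
Lemma subDP x y : W x -> W y -> W (x + y).
Proof. by move=> Wx Wy; rewrite -[x]scale1r; exact: sub_linP. Qed.
Lemma subNP x : W x -> W (- x).
Proof. by rewrite -scaleN1r; exact: subZP. Qed.
Lemma subBP x y : W x -> W y -> W (x - y).
Proof. by move=> Wx /subNP; exact: subDP. Qed.

Definition in_subspace : {pred V} := fun x => `[< W x >].

Lemma in_subspaceP x : reflect (W x) (x \in in_subspace).
Proof. exact: asboolP. Qed.

Lemma in_subspace_submod : submod_closed in_subspace.
Proof.
split; first by apply/in_subspaceP; exact: sub0P.
by move=> a x y /in_subspaceP ? /in_subspaceP ?; apply/in_subspaceP; exact: sub_linP.
Qed.

HB.instance Definition _ :=
  GRing.isSubmodClosed.Build K V in_subspace in_subspace_submod.

Record subsp := Subsp { subsp_val : V; subsp_mem : subsp_val \in in_subspace }.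

HB.instance Definition _ := [isSub for subsp_val].
HB.instance Definition _ := [Choice of subsp by <:].
HB.instance Definition _ := [SubChoice_isSubLmodule of subsp by <:].

Lemma subspP (x : subsp) : W (val x).
Proof. exact/in_subspaceP/valP. Qed.

Definition to_subsp x (Wx : W x) : subsp := Subsp (introT (in_subspaceP x) Wx).

Definition quot_rel (x y : V) : bool := `[< W (x - y) >].

Lemma quot_rel_equiv : equiv_class_of quot_rel.
Proof.
split.
- by move=> x; apply/asboolP; rewrite subrr; exact: sub0P.
- by move=> x y; apply/asboolP/asboolP => /subNP; rewrite opprB.
- move=> y x z /asboolP xy /asboolP yz; apply/asboolP.
  by have := subDP xy yz; rewrite addrA subrK.
Qed.

Canonical quot_equiv := EquivRelPack quot_rel_equiv.

Definition quotsp := {eq_quot quot_equiv}.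
HB.instance Definition _ := Choice.on quotsp.
HB.instance Definition _ := EqQuotient.on quotsp.

Definition to_quot (x : V) : quotsp := \pi_quotsp x.

Lemma to_quotP x y : to_quot x = to_quot y <-> W (x - y).
Proof.
rewrite /to_quot; split=> [/eqP|Wxy]; first by rewrite piE => /asboolP.
by apply/eqP; rewrite piE; exact/asboolP.
Qed.

Lemma to_quot_repr (q : quotsp) : to_quot (repr q) = q.
Proof. exact: reprK. Qed.

Lemma repr_to_quot x : W (repr (to_quot x) - x).
Proof. by apply/to_quotP; rewrite to_quot_repr. Qed.

Definition quot_zero : quotsp := to_quot 0.
Definition quot_opp (p : quotsp) : quotsp := to_quot (- repr p).
Definition quot_add (p q : quotsp) : quotsp := to_quot (repr p + repr q).
Definition quot_scale (a : K) (p : quotsp) : quotsp := to_quot (a *: repr p).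

Lemma quot_oppE x : quot_opp (to_quot x) = to_quot (- x).
Proof.
apply/to_quotP; have := subNP (repr_to_quot x).
by rewrite opprB opprK addrC.
Qed.

Lemma quot_addE x y : quot_add (to_quot x) (to_quot y) = to_quot (x + y).
Proof.
apply/to_quotP; have := subDP (repr_to_quot x) (repr_to_quot y).
by rewrite addrACA opprD.
Qed.

Lemma quot_scaleE a x : quot_scale a (to_quot x) = to_quot (a *: x).
Proof. by apply/to_quotP; rewrite -scalerBr; exact/subZP/repr_to_quot. Qed.

Lemma quot_ind (P : quotsp -> Prop) : (forall x, P (to_quot x)) -> forall q, P q.
Proof. by move=> Px q; rewrite -(to_quot_repr q). Qed.

Lemma quot_addA : associative quot_add.
Proof.
by elim/quot_ind => x; elim/quot_ind => y; elim/quot_ind => z; rewrite !quot_addE addrA.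
Qed.
Lemma quot_addC : commutative quot_add.
Proof. by elim/quot_ind => x; elim/quot_ind => y; rewrite !quot_addE addrC. Qed.
Lemma quot_add0 : left_id quot_zero quot_add.
Proof. by elim/quot_ind => x; rewrite quot_addE add0r. Qed.
Lemma quot_addN : left_inverse quot_zero quot_opp quot_add.
Proof. by elim/quot_ind => x; rewrite quot_oppE quot_addE addNr. Qed.

HB.instance Definition _ :=
  GRing.isZmodule.Build quotsp quot_addA quot_addC quot_add0 quot_addN.

Lemma quot_scaleA a b q : quot_scale a (quot_scale b q) = quot_scale (a * b) q.
Proof. by elim/quot_ind: q => x; rewrite !quot_scaleE scalerA. Qed.
Lemma quot_scale1 : left_id 1 quot_scale.
Proof. by elim/quot_ind => x; rewrite !quot_scaleE scale1r. Qed.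
Lemma quot_scaleDr : right_distributive quot_scale +%R.
Proof.
move=> a; elim/quot_ind => x; elim/quot_ind => y.
by rewrite /GRing.add /= !(quot_addE, quot_scaleE) scalerDr.
Qed.
Lemma quot_scaleDl q : {morph quot_scale^~ q : a b / a + b}.
Proof.
move=> a b; elim/quot_ind: q => x.
by rewrite [RHS]/GRing.add /= !(quot_addE, quot_scaleE) scalerDl.
Qed.

HB.instance Definition _ :=
  GRing.Zmodule_isLmodule.Build K quotsp
    quot_scaleA quot_scale1 quot_scaleDr quot_scaleDl.

Lemma to_quot_linear : linear to_quot.
Proof.
move=> a x y; rewrite /GRing.add /GRing.scale /=.
by rewrite quot_scaleE quot_addE.
Qed.

HB.instance Definition _ :=
  GRing.isLinear.Build K V quotsp *:%R to_quot to_quot_linear.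

End SubspaceTheory.

Arguments to_quot {K V} W x.
Arguments quotsp {K V} W.
Arguments subsp {K V} W.

Section QuotLift.
Variables (K : fieldType) (V U : lmodType K) (W : subspaceOf V).
Variables (f : {linear V -> U}) (fW : forall x, W x -> f x = 0).

Definition quot_lift (q : quotsp W) : U := f (repr q).

Lemma quot_liftE x : quot_lift (to_quot W x) = f x.
Proof. by apply/eqP; rewrite -subr_eq0 -linearB; apply/eqP/fW/repr_to_quot. Qed.

Lemma quot_lift_linear : linear quot_lift.
Proof.
move=> a; elim/quot_ind => x; elim/quot_ind => y.
by rewrite -linearP !quot_liftE linearP.
Qed.

End QuotLift.

Lemma linear_zero (K : fieldType) (U V : lmodType K) (h : U -> V) :
  linear h -> h 0 = 0.
Proof. by move=> /(_ (-1) 0 0); rewrite scaler0 addr0 scaleN1r addNr. Qed.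

Section Linext.
Variables (K : fieldType) (X : choiceType) (V : lmodType K).

Definition linext (f : X -> V) (a : {malg K[X]}) : V :=
  \sum_(x <- msupp a) a@_x *: f x.

Lemma linextEw f (d : {fset X}) a : (msupp a `<=` d)%fset ->
  linext f a = \sum_(x <- d) a@_x *: f x.
Proof.
move=> le; rewrite [LHS](big_fset_incl _ le) => //= x xd /mcoeff_outdom ->.
by rewrite scale0r.
Qed.

Lemma linextU f x : linext f << x >> = f x.
Proof. by rewrite (linextEw _ msuppU_le) big_seq_fset1 mcoeffUU scale1r. Qed.

Lemma linext_linear f : linear (linext f).
Proof.
move=> k a b; set d := (msupp a `|` msupp b)%fset.
have da : (msupp a `<=` d)%fset by exact: fsubsetUl.
have db : (msupp b `<=` d)%fset by exact: fsubsetUr.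
have dab : (msupp (k *: a + b) `<=` d)%fset.
  apply: fsubset_trans (msuppD_le _ _) _.
  by apply: fsetUSS => //; exact: msuppZ_le.
rewrite (linextEw _ da) (linextEw _ db) (linextEw _ dab).
rewrite scaler_sumr -big_split /=; apply: eq_bigr => x _.
by rewrite mcoeffD mcoeffZ scalerDl scalerA.
Qed.

HB.instance Definition _ f :=
  GRing.isLinear.Build K {malg K[X]} V *:%R (linext f) (linext_linear f).

Lemma linext_fun_linear k f g a :
  linext (fun x => k *: f x + g x) a = k *: linext f a + linext g a.
Proof.
rewrite /linext scaler_sumr -big_split /=; apply: eq_bigr => x _.
by rewrite scalerDr !scalerA mulrC.
Qed.

Lemma eq_linext f g a : f =1 g -> linext f a = linext g a.
Proof. by move=> fg; apply: eq_bigr => x _; rewrite fg. Qed.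

Lemma malg_span (W : {malg K[X]} -> Prop) :
  subspace W -> (forall x, W << x >>) -> forall a, W a.
Proof.
move=> [W0 Wlin] Wx a; rewrite (monalgE a); elim/big_ind: _ => //.
- by move=> x y Hx Hy; rewrite -[x]scale1r; exact: Wlin.
- move=> x _; have -> : << a@_x *g x >> = a@_x *: << x >> + 0 :> {malg K[X]}.
    apply/malgP => y; rewrite addr0 mcoeffZ !mcoeffU.
    by rewrite mulrnAr mulr1.
  exact: Wlin.
Qed.

Lemma linear_ext (f g : {malg K[X]} -> V) : linear f -> linear g ->
  (forall x, f << x >> = g << x >>) -> f =1 g.
Proof.
move=> lf lg fg; apply: malg_span => //; split.
  by rewrite !linear_zero.
by move=> a x y ex ey; rewrite lf lg ex ey.
Qed.

End Linext.

Lemma linext_comp (K : fieldType) (X : choiceType) (U V : lmodType K)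
    (h : {linear U -> V}) (f : X -> U) a :
  h (linext f a) = linext (h \o f) a.
Proof. by rewrite linear_sum; apply: eq_bigr => x _; rewrite linearZ. Qed.

Section Linext2.
Variables (K : fieldType) (X Y : choiceType) (V : lmodType K).
Variable f : X -> Y -> V.

Definition linext2 (a : {malg K[X]}) (b : {malg K[Y]}) : V :=
  linext (fun x => linext (f x) b) a.

Lemma linext2UU x y : linext2 << x >> << y >> = f x y.
Proof. by rewrite /linext2 !linextU. Qed.

Lemma linext2_linearl b : linear (linext2^~ b).
Proof. exact: linext_linear. Qed.

Lemma linext2_linearr a : linear (linext2 a).
Proof.
move=> k b c; rewrite /linext2 -linext_fun_linear; apply: eq_linext => x.
exact: linext_linear.
Qed.

End Linext2.

Definition bilin (K : fieldType) (U V W : lmodType K) (f : U -> V -> W) :=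
  (forall v, linear (f^~ v)) /\ (forall u, linear (f u)).

Lemma linext2_bilinear (K : fieldType) (X Y : choiceType) (V : lmodType K)
  (f : X -> Y -> V) : bilin (linext2 f).
Proof. by split; [exact: linext2_linearl | exact: linext2_linearr]. Qed.

(* Associative K-algebras, not necessarily unital: the path algebra of a graph
   with infinitely many vertices has no identity. *)
Record nualgebra (K : fieldType) := NUAlgebra {
  nua_sort :> lmodType K;
  nua_mul : nua_sort -> nua_sort -> nua_sort;
  nua_mul_bilinear : bilin nua_mul;
  nua_mulA : associative nua_mul }.

Record lmodule (K : fieldType) (A : nualgebra K) := LModule {
  lm_sort :> lmodType K;
  lm_act : A -> lm_sort -> lm_sort;
  lm_act_bilinear : bilin lm_act;
  lm_actA : forall a b m, lm_act a (lm_act b m) = lm_act (nua_mul a b) m }.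

(* The homogeneous components are data here; that they do form a grading is the
   predicate [graded] below. *)
Record gralgebra (K : fieldType) := GrAlgebra {
  gra_alg :> nualgebra K;
  gra_deg : int -> gra_alg -> Prop }.

Record grmodule (K : fieldType) (A : gralgebra K) := GrModule {
  grm_mod :> lmodule A;
  grm_deg : int -> grm_mod -> Prop }.

Record grbimodule (K : fieldType) (A B : gralgebra K) := GrBimodule {
  bim_left :> grmodule A;
  bim_ract : bim_left -> B -> bim_left;
  bim_ract_bilinear : bilin bim_ract;
  bim_ractA : forall m b c,
    bim_ract (bim_ract m b) c = bim_ract m (nua_mul b c);
  bim_actC : forall a m b,
    lm_act a (bim_ract m b) = bim_ract (lm_act a m) b }.

Section GradedModules.
Variables (K : fieldType) (A : gralgebra K).

Definition graded (M : grmodule A) : Prop :=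
  [/\ forall n, subspace (@grm_deg _ _ M n),
      forall x : M, exists (s : seq int) (f : int -> M),
        (forall n, grm_deg n (f n)) /\ x = \sum_(n <- s) f n,
      forall (s : seq int) (f : int -> M), uniq s ->
        (forall n, grm_deg n (f n)) -> \sum_(n <- s) f n = 0 ->
        forall n, n \in s -> f n = 0 &
      forall m n (a : A) (x : M), gra_deg m a -> grm_deg n x ->
        grm_deg (m + n) (lm_act a x)].

Definition graded_submodule (M : grmodule A) (U : M -> Prop) : Prop :=
  [/\ subspace U,
      forall (a : A) x, U x -> U (lm_act a x) &
      forall x, U x -> exists (s : seq int) (f : int -> M),
        (forall n, U (f n) /\ grm_deg n (f n)) /\ x = \sum_(n <- s) f n].

Definition graded_simple (M : grmodule A) : Prop :=
  [/\ graded M,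
      exists x : M, x <> 0 &
      forall U : M -> Prop, graded_submodule U ->
        (forall x, U x -> x = 0) \/ (forall x, U x)].

Definition graded_isomorphic (M N : grmodule A) : Prop :=
  exists f : M -> N,
    [/\ linear f, bijective f,
        forall (a : A) x, f (lm_act a x) = lm_act a (f x) &
        forall n x, grm_deg n x <-> grm_deg n (f x)].

Definition regular_module : grmodule A :=
  @GrModule _ A (LModule (@nua_mul_bilinear _ A) (@nua_mulA _ A)) (@gra_deg _ A).

End GradedModules.

Lemma linear_comp (K : fieldType) (U V W : lmodType K) (f : V -> W) (g : U -> V) :
  linear f -> linear g -> linear (fun x => f (g x)).
Proof. by move=> lf lg a x y; rewrite lg lf. Qed.

Lemma linear_combi (K : fieldType) (U V : lmodType K) (f g : U -> V) k :
  linear f -> linear g -> linear (fun x => k *: f x + g x).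
Proof.
move=> lf lg c x y; rewrite lf lg !scalerDr !scalerA (mulrC c) -!addrA.
by congr (_ + _); rewrite addrCA.
Qed.

Section SemigroupAlgebra.
Variables (K : fieldType) (G : semigroupType).

Definition sga_mul : {malg K[G]} -> {malg K[G]} -> {malg K[G]} :=
  linext2 (fun g h => << (g * h)%g >>).

Lemma sga_mul_bilinear : bilin sga_mul.
Proof. exact: linext2_bilinear. Qed.

Lemma sga_mulUU g h : sga_mul << g >> << h >> = << (g * h)%g >>.
Proof. exact: linext2UU. Qed.

Lemma sga_mulA : associative sga_mul.
Proof.
have [ll lr] := sga_mul_bilinear.
move=> a b c; move: a; apply: linear_ext => [||g]; first exact: ll.
  exact: (linear_comp (ll c) (ll b)).
move: b; apply: linear_ext => [||h].
- exact: (linear_comp (lr << g >>) (ll c)).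
- exact: (linear_comp (ll c) (lr << g >>)).
move: c; apply: linear_ext => [||k].
- exact: (linear_comp (lr << g >>) (lr << h >>)).
- exact: lr.
by rewrite !sga_mulUU mulgA.
Qed.

Definition semigroup_algebra : nualgebra K :=
  NUAlgebra sga_mul_bilinear sga_mulA.

End SemigroupAlgebra.

Section QuotientAlgebra.
Variables (K : fieldType) (A : nualgebra K) (R : A -> Prop).

Inductive ideal_gen : A -> Prop :=
| ideal_in x : R x -> ideal_gen x
| ideal_zero : ideal_gen 0
| ideal_lin a x y : ideal_gen x -> ideal_gen y -> ideal_gen (a *: x + y)
| ideal_mull x y : ideal_gen y -> ideal_gen (nua_mul x y)
| ideal_mulr x y : ideal_gen x -> ideal_gen (nua_mul x y).

Lemma ideal_subspace : subspace ideal_gen.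
Proof. by split; [exact: ideal_zero | exact: ideal_lin]. Qed.

Definition ideal : subspaceOf A := SubspaceOf ideal_subspace.

Local Notation Q := (quotsp ideal).

Definition qa_mul (p q : Q) : Q := to_quot ideal (nua_mul (repr p) (repr q)).

Lemma nua_mulBl (a b c : A) : nua_mul (a - b) c = nua_mul a c - nua_mul b c.
Proof.
have l := (nua_mul_bilinear A).1 c.
by rewrite -scaleN1r addrC l scaleN1r addrC.
Qed.

Lemma nua_mulBr (a b c : A) : nua_mul c (a - b) = nua_mul c a - nua_mul c b.
Proof.
have l := (nua_mul_bilinear A).2 c.
by rewrite -scaleN1r addrC l scaleN1r addrC.
Qed.

Lemma qa_mulE x y :
  qa_mul (to_quot ideal x) (to_quot ideal y) = to_quot ideal (nua_mul x y).
Proof.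
apply/to_quotP; set x' := repr _; set y' := repr _.
have -> : nua_mul x' y' - nua_mul x y =
    nua_mul (x' - x) y' + nua_mul x (y' - y).
  by rewrite nua_mulBl nua_mulBr addrA subrK.
apply: subDP; first by apply: ideal_mulr; exact: (repr_to_quot ideal x).
by apply: ideal_mull; exact: (repr_to_quot ideal y).
Qed.

Lemma qa_mul_bilinear : bilin qa_mul.
Proof.
split=> [v k x y|u k x y].
  elim/quot_ind: v => v; elim/quot_ind: x => x; elim/quot_ind: y => y.
  by rewrite -linearP !qa_mulE -linearP (nua_mul_bilinear A).1.
elim/quot_ind: u => u; elim/quot_ind: x => x; elim/quot_ind: y => y.
by rewrite -linearP !qa_mulE -linearP (nua_mul_bilinear A).2.
Qed.

Lemma qa_mulA : associative qa_mul.
Proof.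
elim/quot_ind => x; elim/quot_ind => y; elim/quot_ind => z.
by rewrite !qa_mulE nua_mulA.
Qed.

Definition quotient_algebra : nualgebra K := NUAlgebra qa_mul_bilinear qa_mulA.

End QuotientAlgebra.

Section Tensor.
Variables (K : fieldType) (A B : gralgebra K).
Variables (M : grbimodule A B) (N : grmodule B).

Inductive tensor_rel : {malg K[(M * N)%type]} -> Prop :=
| tensor_linl k m m' n :
    tensor_rel (<< (k *: m + m', n) >> - (k *: << (m, n) >> + << (m', n) >>))
| tensor_linr k m n n' :
    tensor_rel (<< (m, k *: n + n') >> - (k *: << (m, n) >> + << (m, n') >>))
| tensor_bal m b n :
    tensor_rel (<< (bim_ract m b, n) >> - << (m, lm_act b n) >>).

Definition tensor_sp := quotsp (spanOf tensor_rel).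

Definition tensor (m : M) (n : N) : tensor_sp :=
  to_quot (spanOf tensor_rel) << (m, n) >>.

Lemma tensor_eq x y : tensor_rel (x - y) ->
  to_quot (spanOf tensor_rel) x = to_quot (spanOf tensor_rel) y.
Proof. by move=> h; apply/to_quotP; exact: span_gen. Qed.

Lemma tensor_linear_l n : linear (tensor^~ n).
Proof. by move=> k m m'; rewrite /tensor -linearP; exact/tensor_eq/tensor_linl. Qed.

Lemma tensor_linear_r m : linear (tensor m).
Proof. by move=> k n n'; rewrite /tensor -linearP; exact/tensor_eq/tensor_linr. Qed.

Lemma tensorC m b n : tensor (bim_ract m b) n = tensor m (lm_act b n).
Proof. exact/tensor_eq/tensor_bal. Qed.

Definition tensor_pre_act (a : A) : {linear {malg K[(M * N)%type]} -> tensor_sp} :=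
  linext (fun p => tensor (lm_act a p.1) p.2).

Lemma tensor_pre_actU a m n :
  tensor_pre_act a << (m, n) >> = tensor (lm_act a m) n.
Proof. exact: linextU. Qed.

Lemma tensor_pre_act_rel a x : spanOf tensor_rel x -> tensor_pre_act a x = 0.
Proof.
have lM := (lm_act_bilinear M).2 a.
elim=> [{}x []|| k y z _ Hy _ Hz].
- move=> k m m' n; rewrite linearB linearP !tensor_pre_actU.
  by rewrite lM tensor_linear_l subrr.
- move=> k m n n'; rewrite linearB linearP !tensor_pre_actU.
  by rewrite tensor_linear_r subrr.
- move=> m b n; rewrite linearB !tensor_pre_actU.
  by rewrite bim_actC tensorC subrr.
- exact: linear0.
- by rewrite linearP Hy Hz scaler0 addr0.
Qed.

(* a (m (x) n) = (a m) (x) n, see [tensor_actE] *)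
Definition tensor_act (a : A) : tensor_sp -> tensor_sp :=
  quot_lift (W := spanOf tensor_rel) (tensor_pre_act a).

Lemma tensor_act_linear a : linear (tensor_act a).
Proof. exact/quot_lift_linear/tensor_pre_act_rel. Qed.

Lemma tensor_actE a m n : tensor_act a (tensor m n) = tensor (lm_act a m) n.
Proof.
by rewrite /tensor_act /tensor quot_liftE ?tensor_pre_actU //; exact: tensor_pre_act_rel.
Qed.

Lemma tensor_ext (f g : tensor_sp -> tensor_sp) : linear f -> linear g ->
  (forall m n, f (tensor m n) = g (tensor m n)) -> f =1 g.
Proof.
move=> lf lg fg; elim/quot_ind => x; move: x.
apply: (linear_ext (linear_comp lf (to_quot_linear _)) (linear_comp lg (to_quot_linear _))).
by case=> m n; exact: fg.
Qed.

Lemma tensor_act_bilinear : bilin tensor_act.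
Proof.
split=> [v k a b|]; last exact: tensor_act_linear.
move: v; apply: tensor_ext.
- exact: tensor_act_linear.
- exact: linear_combi (tensor_act_linear a) (tensor_act_linear b).
by move=> m n; rewrite !tensor_actE (lm_act_bilinear M).1 tensor_linear_l.
Qed.

Lemma tensor_actA a b x :
  tensor_act a (tensor_act b x) = tensor_act (nua_mul a b) x.
Proof.
move: x; apply: tensor_ext => [||m n].
- exact: linear_comp (tensor_act_linear a) (tensor_act_linear b).
- exact: tensor_act_linear.
- by rewrite !tensor_actE lm_actA.
Qed.

Definition tensor_deg (n : int) : tensor_sp -> Prop :=
  lspan (fun x => exists i j m p,
    [/\ grm_deg i m, grm_deg j p, i + j = n & x = tensor m p]).

Definition tensor_product : grmodule A :=
  @GrModule _ A (LModule tensor_act_bilinear tensor_actA) tensor_deg.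

End Tensor.

Record digraph := Digraph {
  vertex : Type;
  edge : Type;
  esrc : edge -> vertex;
  erng : edge -> vertex }.

HB.instance Definition _ (E : digraph) := gen_eqMixin (vertex E).
HB.instance Definition _ (E : digraph) := gen_choiceMixin (vertex E).
HB.instance Definition _ (E : digraph) := gen_eqMixin (edge E).
HB.instance Definition _ (E : digraph) := gen_choiceMixin (edge E).

Section Paths.
Variable E : digraph.

Definition out_edges (v : vertex E) : set (edge E) := [set e | esrc e = v].

Definition singular (v : vertex E) : Prop :=
  out_edges v = set0 \/ infinite_set (out_edges v).

Fixpoint walk (v : vertex E) (es : seq (edge E)) : bool :=
  if es is e :: es' then (esrc e == v) && walk (erng e) es' else true.

Definition walk_end (v : vertex E) (es : seq (edge E)) : vertex E :=
  last v [seq erng e | e <- es].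

(* The source is recorded in order to distinguish the paths of length 0. *)
Record finpath := FinPath {
  fsrc : vertex E;
  fedges : seq (edge E);
  fpathP : walk fsrc fedges }.

Definition frng (mu : finpath) : vertex E := walk_end (fsrc mu) (fedges mu).
Definition flen (mu : finpath) : nat := size (fedges mu).

Definition vpath (v : vertex E) : finpath := @FinPath v [::] isT.

Lemma epath_walk (e : edge E) : walk (esrc e) [:: e].
Proof. by rewrite /= eqxx. Qed.
Definition epath (e : edge E) : finpath := FinPath (epath_walk e).

Record ipath := IPath {
  iedge : nat -> edge E;
  ipathP : forall i, erng (iedge i) = esrc (iedge i.+1) }.

Inductive bpath :=
| BFin (mu : finpath) of singular (frng mu)
| BInf of ipath.

Definition bsrc (x : bpath) : vertex E :=
  match x with BFin mu _ => fsrc mu | BInf p => esrc (iedge p 0) end.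

Lemma walk_cat v es es' : walk v (es ++ es') = walk v es && walk (walk_end v es) es'.
Proof. by elim: es v => //= e es IH v; rewrite IH andbA. Qed.

Lemma walk_end_cat v es es' : walk_end v (es ++ es') = walk_end (walk_end v es) es'.
Proof. by rewrite /walk_end map_cat last_cat. Qed.

Lemma fcat_walk (mu nu : finpath) : frng mu = fsrc nu ->
  walk (fsrc mu) (fedges mu ++ fedges nu).
Proof. by move=> h; rewrite walk_cat fpathP /= [walk_end _ _]h fpathP. Qed.

Definition fcat (mu nu : finpath) (h : frng mu = fsrc nu) : finpath :=
  FinPath (fcat_walk h).

Lemma frng_fcat mu nu (h : frng mu = fsrc nu) : frng (fcat h) = frng nu.
Proof. by rewrite /frng /= walk_end_cat [walk_end (fsrc mu) _]h. Qed.

Lemma flen_fcat mu nu (h : frng mu = fsrc nu) : flen (fcat h) = (flen mu + flen nu)%N.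
Proof. by rewrite /flen size_cat. Qed.

Lemma walk_nth v es d i : walk v es -> (i.+1 < size es)%N ->
  erng (nth d es i) = esrc (nth d es i.+1).
Proof.
elim: es v i => // e es IH v [|i] /= /andP[_ w] lti; last exact: IH w lti.
by case: es w lti {IH} => // f es /= /andP[/eqP->].
Qed.

Lemma walk_end_nth v es d : (0 < size es)%N ->
  walk_end v es = erng (nth d es (size es).-1).
Proof.
by case: es => // e es _; rewrite /walk_end /= last_map (last_nth d).
Qed.

Lemma walk_nth0 v es d : walk v es -> (0 < size es)%N -> esrc (nth d es 0) = v.
Proof. by case: es => //= e es /andP[/eqP]. Qed.

Definition icat_edge (mu : finpath) (p : ipath) (i : nat) : edge E :=
  nth (iedge p (i - flen mu)) (fedges mu) i.

Lemma icat_subproof mu p : frng mu = esrc (iedge p 0) ->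
  forall i, erng (icat_edge mu p i) = esrc (icat_edge mu p i.+1).
Proof.
move=> h i; rewrite /icat_edge; case: (ltngtP i.+1 (flen mu)) => lti.
- rewrite (set_nth_default (iedge p (i.+1 - flen mu)) _ (ltnW lti)).
  exact: walk_nth (fpathP mu) lti.
- rewrite !nth_default // ?(ltnW lti) // subSn // ipathP //.
- rewrite [in RHS]nth_default -/(flen mu) ?lti // subnn -h /frng.
  rewrite (@walk_end_nth _ _ (iedge p (i - flen mu))) -/(flen mu) -lti //.
Qed.

Definition icat mu p (h : frng mu = esrc (iedge p 0)) : ipath :=
  IPath (icat_subproof h).

Lemma fcat_singular mu nu (h : frng mu = fsrc nu) :
  singular (frng nu) -> singular (frng (fcat h)).
Proof. by rewrite frng_fcat. Qed.

Definition bcat (mu : finpath) (p : bpath) : frng mu = bsrc p -> bpath :=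
  match p with
  | BFin nu hs => fun h => BFin (fcat_singular h hs)
  | BInf q => fun h => BInf (icat h)
  end.

(* Boundary paths are determined by their source and their sequence of edges. *)
Definition bedge (x : bpath) (i : nat) : option (edge E) :=
  match x with BFin mu _ => onth (fedges mu) i | BInf p => Some (iedge p i) end.

Lemma fpath_eq (mu nu : finpath) :
  fsrc mu = fsrc nu -> fedges mu = fedges nu -> mu = nu.
Proof.
case: mu nu => [v es w] [v' es' w'] /= ev ees; subst v' es'.
by rewrite (bool_irrelevance w w').
Qed.

Lemma BFin_eq mu nu (hm : singular (frng mu)) (hn : singular (frng nu)) :
  mu = nu -> BFin hm = BFin hn.
Proof. by move=> e; subst nu; rewrite (Prop_irrelevance hm hn). Qed.

Lemma bpath_eq (x y : bpath) : bsrc x = bsrc y -> bedge x =1 bedge y -> x = y.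
Proof.
case: x y => [mu hm|p] [nu hn|q] /= es ee.
- by apply/BFin_eq/fpath_eq => //; exact: eq_from_onth.
- by have := ee (size (fedges mu)); rewrite /= onth_default.
- by have := ee (size (fedges nu)); rewrite /= onth_default.
- case: p q ee {es} => [p hp] [q hq] /= ee; have epq : p = q.
    by apply/funext => i; case: (ee i).
  by subst q; rewrite (Prop_irrelevance hp hq).
Qed.

Lemma bsrc_bcat mu p (h : frng mu = bsrc p) : bsrc (bcat h) = fsrc mu.
Proof.
case: p h => [nu hs|q] //= h; rewrite /icat_edge sub0n.
case: mu h => v [|e es] w /=; rewrite /frng /walk_end //=.
by case/andP: w => /eqP.
Qed.

Lemma bedge_bcat mu p (h : frng mu = bsrc p) i :
  bedge (bcat h) i = if (i < flen mu)%N then onth (fedges mu) i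
                     else bedge p (i - flen mu).
Proof.
case: p h => [nu hs|q] /= h; first by rewrite onth_cat.
rewrite /icat_edge; case: ltnP => lti; last by rewrite nth_default.
by rewrite (onthE _ i) /= (nth_map (iedge q (i - flen mu))).
Qed.

Lemma bcat_inj mu p q (hp : frng mu = bsrc p) (hq : frng mu = bsrc q) :
  bcat hp = bcat hq -> p = q.
Proof.
move=> e; apply: bpath_eq => [|i]; first by rewrite -hp -hq.
have := congr1 (bedge^~ (i + flen mu)%N) e.
by rewrite !bedge_bcat !ltnNge leq_addl /= addnK.
Qed.

Lemma bcat_eq mu nu p (hm : frng mu = bsrc p) (hn : frng nu = bsrc p) :
  mu = nu -> bcat hm = bcat hn.
Proof. by move=> e; subst nu; rewrite (Prop_irrelevance hm hn). Qed.

Lemma bcatA mu nu p (h : frng mu = fsrc nu) (hn : frng nu = bsrc p)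
    (h' : frng (fcat h) = bsrc p) (h'' : frng mu = bsrc (bcat hn)) :
  bcat h' = bcat h''.
Proof.
apply: bpath_eq => [|i]; first by rewrite !bsrc_bcat.
rewrite !bedge_bcat flen_fcat onth_cat.
case: (ltnP i (flen mu)) => hi; first by rewrite ltn_addr.
by rewrite ltn_subLR // subnDA.
Qed.

Lemma bcat_prefix mu nu p q (hp : frng mu = bsrc p) (hq : frng nu = bsrc q) :
    bcat hp = bcat hq -> (flen mu <= flen nu)%N ->
  exists ka (h : frng mu = fsrc ka) (h' : frng ka = bsrc q),
    nu = fcat h /\ p = bcat h'.
Proof.
move=> e le.
have esrcs : fsrc mu = fsrc nu by rewrite -(bsrc_bcat hp) e bsrc_bcat.
have etake : take (flen mu) (fedges nu) = fedges mu.
  apply: eq_from_onth => i; have := congr1 (bedge^~ i) e; rewrite !bedge_bcat.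
  case: (ltnP i (flen mu)) => hi.
    by rewrite (leq_trans hi le) => ->; rewrite !onthE map_take nth_take.
  by move=> _; rewrite !onth_default // size_take_min geq_min hi.
have enu := cat_take_drop (flen mu) (fedges nu).
have wka : walk (frng mu) (drop (flen mu) (fedges nu)).
  by have := fpathP nu; rewrite -{1}enu walk_cat etake -esrcs => /andP[].
pose ka := FinPath wka; have hka : frng mu = fsrc ka by [].
have e1 : nu = fcat hka.
  by apply: fpath_eq; rewrite /= -?esrcs // -{1}enu etake.
have h' : frng ka = bsrc q by rewrite -hq [in RHS]e1 frng_fcat.
exists ka, hka, h'; split=> //.
have h'' : frng mu = bsrc (bcat h') by rewrite bsrc_bcat.
have hq' : frng (fcat hka) = bsrc q by rewrite -e1.
apply: (bcat_inj (hp := hp) (hq := h'')); rewrite e (bcat_eq hq hq' e1).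
exact: bcatA.
Qed.

Lemma bcat_vpath p (h : frng (vpath (bsrc p)) = bsrc p) : bcat h = p.
Proof.
apply: bpath_eq => [|i]; first by rewrite bsrc_bcat.
by rewrite bedge_bcat subn0.
Qed.

End Paths.

Section Groupoid.
Variable E : digraph.

(* x ~_k y *)
Definition tail_equiv (k : int) (x y : bpath E) : Prop :=
  exists (mu nu : finpath E) (p : bpath E)
         (hm : frng mu = bsrc p) (hn : frng nu = bsrc p),
    [/\ x = bcat hm, y = bcat hn & k = (flen mu)%:Z - (flen nu)%:Z].

Lemma tail_equiv_refl x : tail_equiv 0 x x.
Proof.
have h : frng (vpath (bsrc x)) = bsrc x by [].
exists (vpath (bsrc x)), (vpath (bsrc x)), x, h, h.
by rewrite bcat_vpath subrr.
Qed.

Lemma tail_equiv_sym k x y : tail_equiv k x y -> tail_equiv (- k) y x.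
Proof.
by move=> [mu [nu [p [hm [hn [-> -> ->]]]]]]; exists nu, mu, p, hn, hm; rewrite opprB.
Qed.

Lemma tail_equiv_trans k l x y z :
  tail_equiv k x y -> tail_equiv l y z -> tail_equiv (k + l) x z.
Proof.
have main mu nu al be (p q : bpath E) (hm : frng mu = bsrc p) (hn : frng nu = bsrc p)
    (ha : frng al = bsrc q) (hb : frng be = bsrc q) :
    (flen nu <= flen al)%N -> bcat hn = bcat ha ->
    tail_equiv ((flen mu)%:Z - (flen nu)%:Z + ((flen al)%:Z - (flen be)%:Z))
      (bcat hm) (bcat hb).
  move=> le e; have [ka [h [h' [eal ep]]]] := bcat_prefix e le.
  have hmk : frng mu = fsrc ka by rewrite hm ep bsrc_bcat.
  have hmk' : frng (fcat hmk) = bsrc q by rewrite frng_fcat.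
  exists (fcat hmk), be, q, hmk', hb; split=> //.
    by subst p; rewrite (bcatA hmk' hm).
  rewrite flen_fcat eal flen_fcat !PoszD.
  by rewrite addrA -(addrA _ (- _)) addKr.
move=> [mu [nu [p [hm [hn [-> -> ->]]]]]] [al [be [q [ha [hb [e -> ->]]]]]].
case: (leqP (flen nu) (flen al)) => le; first exact: main le e.
have /tail_equiv_sym := main be al nu mu q p hb ha hn hm (ltnW le) (esym e).
by rewrite opprD !opprB addrC.
Qed.

Record groupoid := Gpd {
  gpd_c : bpath E;
  gpd_k : int;
  gpd_d : bpath E;
  gpdP : tail_equiv gpd_k gpd_c gpd_d }.

Lemma gpd_eq g h :
  gpd_c g = gpd_c h -> gpd_k g = gpd_k h -> gpd_d g = gpd_d h -> g = h.
Proof.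
case: g h => [x k y w] [x' k' y' w'] /= e1 e2 e3; subst x' k' y'.
by rewrite (Prop_irrelevance w w').
Qed.

Lemma gpd_mul_subproof g h : gpd_d g = gpd_c h ->
  tail_equiv (gpd_k g + gpd_k h) (gpd_c g) (gpd_d h).
Proof. by move=> e; apply: tail_equiv_trans (gpdP g) _; rewrite e; exact: gpdP. Qed.

Definition gpd_mul g h (e : gpd_d g = gpd_c h) : groupoid :=
  Gpd (gpd_mul_subproof e).
Definition gpd_inv g : groupoid := Gpd (tail_equiv_sym (gpdP g)).
Definition gpd_unit x : groupoid := Gpd (tail_equiv_refl x).

Section At.
Variable x : bpath E.

Record isotropy := Isotropy {
  iso_elt :> groupoid;
  iso_c : gpd_c iso_elt = x;
  iso_d : gpd_d iso_elt = x }.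

HB.instance Definition _ := gen_eqMixin isotropy.
HB.instance Definition _ := gen_choiceMixin isotropy.

Lemma isotropy_eq (g h : isotropy) : gpd_k g = gpd_k h -> g = h.
Proof.
case: g h => [g cg dg] [h ch dh] /= e.
have {e} e : g = h by apply: gpd_eq; rewrite ?cg ?ch ?dg ?dh.
by subst h; rewrite (Prop_irrelevance cg ch) (Prop_irrelevance dg dh).
Qed.

Definition iso_one : isotropy := @Isotropy (gpd_unit x) erefl erefl.
Definition iso_inv (g : isotropy) : isotropy :=
  @Isotropy (gpd_inv g) (iso_d g) (iso_c g).
Definition iso_mul (g h : isotropy) : isotropy :=
  @Isotropy (gpd_mul (etrans (iso_d g) (esym (iso_c h)))) (iso_c g) (iso_d h).

Lemma iso_mulA : associative iso_mul.
Proof. by move=> f g h; apply: isotropy_eq; rewrite /= addrA. Qed.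
Lemma iso_mul1 : left_id iso_one iso_mul.
Proof. by move=> g; apply: isotropy_eq; rewrite /= add0r. Qed.
Lemma iso_1mul : right_id iso_one iso_mul.
Proof. by move=> g; apply: isotropy_eq; rewrite /= addr0. Qed.
Lemma iso_mulV : left_inverse iso_one iso_inv iso_mul.
Proof. by move=> g; apply: isotropy_eq; rewrite /= addNr. Qed.
Lemma iso_Vmul : right_inverse iso_one iso_inv iso_mul.
Proof. by move=> g; apply: isotropy_eq; rewrite /= addrN. Qed.

HB.instance Definition _ :=
  isGroup.Build isotropy iso_mulA iso_mul1 iso_1mul iso_mulV iso_Vmul.

(* L_x *)
Record Lset := LElt {
  L_elt :> groupoid;
  L_d : gpd_d L_elt = x }.

HB.instance Definition _ := gen_eqMixin Lset.
HB.instance Definition _ := gen_choiceMixin Lset.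

Lemma Lset_eq (g h : Lset) :
  gpd_c g = gpd_c h -> gpd_k g = gpd_k h -> g = h.
Proof.
case: g h => [g dg] [h dh] /= e1 e2.
have e : g = h by apply: gpd_eq; rewrite ?dg ?dh.
by subst h; rewrite (Prop_irrelevance dg dh).
Qed.

Definition L_mul (g : Lset) (h : isotropy) : Lset :=
  @LElt (gpd_mul (etrans (L_d g) (esym (iso_c h)))) (iso_d h).

Lemma L_mulA g (h k : isotropy) : L_mul (L_mul g h) k = L_mul g (h * k)%g.
Proof. by apply: Lset_eq; rewrite //= -addrA. Qed.

End At.
End Groupoid.

Definition isotropy_algebra (K : fieldType) (E : digraph) (x : bpath E) : gralgebra K :=
  @GrAlgebra K (semigroup_algebra K (isotropy x))
    (fun n => lspan (fun a => exists2 g : isotropy x, gpd_k g = n & a = << g >>)).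

Section Leavitt.
Variables (K : fieldType) (E : digraph).

Inductive generator :=
| GV of vertex E
| GE of edge E
| GS of edge E. (* e^* *)

HB.instance Definition _ := gen_eqMixin generator.
HB.instance Definition _ := gen_choiceMixin generator.

(* Nonempty words: the free algebra on the generators has no identity. *)
Definition word : Type := (generator * seq generator)%type.
HB.instance Definition _ := Choice.on word.

Definition word_mul (w w' : word) : word := (w.1, w.2 ++ w'.1 :: w'.2).

Lemma word_mulA : associative word_mul.
Proof. by move=> u v w; rewrite /word_mul /= -catA. Qed.

HB.instance Definition _ := isSemigroup.Build word word_mulA.

Definition free_alg : nualgebra K := semigroup_algebra K word.

Definition gen (g : generator) : free_alg := << ((g, [::]) : word) >>.

Local Notation "a ** b" := (nua_mul a b) (at level 40, left associativity).

Inductive leavitt_rel : free_alg -> Prop :=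
| leavitt_vw v w :
    leavitt_rel (gen (GV v) ** gen (GV w) - (if v == w then gen (GV v) else 0))
| leavitt_se e : leavitt_rel (gen (GV (esrc e)) ** gen (GE e) - gen (GE e))
| leavitt_er e : leavitt_rel (gen (GE e) ** gen (GV (erng e)) - gen (GE e))
| leavitt_rs e : leavitt_rel (gen (GV (erng e)) ** gen (GS e) - gen (GS e))
| leavitt_ss e : leavitt_rel (gen (GS e) ** gen (GV (esrc e)) - gen (GS e))
| leavitt_ck1 e f :
    leavitt_rel (gen (GS e) ** gen (GE f) -
                 (if e == f then gen (GV (erng e)) else 0))
| leavitt_ck2 v : ~ singular v ->
    leavitt_rel (gen (GV v) -
                 \sum_(e \in out_edges v) gen (GE e) ** gen (GS e)).

Definition leavitt_nua : nualgebra K := quotient_algebra leavitt_rel.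

Definition leavitt_word (w : word) : leavitt_nua :=
  to_quot (ideal leavitt_rel) << w >>.

Definition word_of (g0 : generator) (gs : seq generator) : word :=
  if gs is g :: gs' then (g, gs') else (g0, [::]).

(* mu and nu^* in L_K(E); a path of length 0 is its vertex *)
Definition leavitt_path (mu : finpath E) : leavitt_nua :=
  leavitt_word (word_of (GV (fsrc mu)) [seq GE e | e <- fedges mu]).
Definition leavitt_ghost (nu : finpath E) : leavitt_nua :=
  leavitt_word (word_of (GV (fsrc nu)) [seq GS e | e <- rev (fedges nu)]).

Definition leavitt_mon (mu nu : finpath E) : leavitt_nua :=
  leavitt_path mu ** leavitt_ghost nu.

Definition leavitt_deg (n : int) : leavitt_nua -> Prop :=
  lspan (fun a => exists mu nu, [/\ frng mu = frng nu,
    (flen mu)%:Z - (flen nu)%:Z = n & a = leavitt_mon mu nu]).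

Definition leavitt : gralgebra K := @GrAlgebra K leavitt_nua leavitt_deg.

Lemma leavitt_rel_eq x y : leavitt_rel (x - y) ->
  to_quot (ideal leavitt_rel) x = to_quot (ideal leavitt_rel) y.
Proof. by move=> h; apply/to_quotP; exact: ideal_in. Qed.

Lemma leavitt_wordM w w' :
  leavitt_word w ** leavitt_word w' = leavitt_word (w * w')%g.
Proof. by rewrite /leavitt_word /= qa_mulE /= sga_mulUU. Qed.

Lemma leavitt_linear_ext (V : lmodType K) (f g : leavitt_nua -> V) :
  linear f -> linear g -> (forall w, f (leavitt_word w) = g (leavitt_word w)) ->
  f =1 g.
Proof.
move=> lf lg fg; elim/quot_ind => x; move: x.
exact: (linear_ext (linear_comp lf (to_quot_linear _)) (linear_comp lg (to_quot_linear _))).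
Qed.

Section Representation.
Variables (M : lmodType K) (rho : generator -> {linear M -> M}).

Definition word_op (w : word) (m : M) : M := foldr (fun g m => rho g m) m (w.1 :: w.2).

Lemma word_op_linear w : linear (word_op w).
Proof.
rewrite /word_op; elim: (_ :: _) => [//|g gs IH] a m n /=.
by rewrite IH linearP.
Qed.

Lemma word_opM w w' m : word_op (w * w')%g m = word_op w (word_op w' m).
Proof. by rewrite /word_op /= foldr_cat. Qed.

Definition free_act (m : M) : {linear free_alg -> M} := linext (word_op^~ m).

Lemma free_act_linear a : linear (fun m => free_act m a).
Proof.
move=> k m n; rewrite -[RHS]linext_fun_linear; apply: eq_linext => w.
exact: word_op_linear.
Qed.

Lemma free_actU w m : free_act m << w >> = word_op w m.
Proof. exact: linextU. Qed.

Lemma free_act_gen g m : free_act m (gen g) = rho g m.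
Proof. exact: free_actU. Qed.

Lemma free_actA a b m : free_act m (a ** b) = free_act (free_act m b) a.
Proof.
have [ll lr] := nua_mul_bilinear free_alg.
move: a; apply: linear_ext => [||w].
- exact: linear_comp (@linearP _ _ _ _ (free_act m)) (ll b).
- exact: linearP.
move: b; apply: linear_ext => [||w'].
- exact: linear_comp (@linearP _ _ _ _ (free_act m)) (lr << w >>).
- exact: linear_comp (free_act_linear << w >>) (@linearP _ _ _ _ (free_act m)).
by rewrite /= sga_mulUU !free_actU word_opM.
Qed.

Hypothesis rhoP : forall a m, leavitt_rel a -> free_act m a = 0.

Lemma free_act_ideal m a : ideal leavitt_rel a -> free_act m a = 0.
Proof.
move=> h; elim: h m => {a} [a Ra m|m|k x y _ Hx _ Hy m|x y _ Hy m|x y _ Hx m].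
- exact: rhoP.
- exact: linear0.
- by rewrite linearP Hx Hy scaler0 addr0.
- by rewrite free_actA Hy (linear_zero (free_act_linear x)).
- by rewrite free_actA Hx.
Qed.

Definition leavitt_act (a : leavitt_nua) (m : M) : M :=
  quot_lift (W := ideal leavitt_rel) (free_act m) a.

Lemma leavitt_actE a m :
  leavitt_act (to_quot (ideal leavitt_rel) a) m = free_act m a.
Proof. exact/quot_liftE/free_act_ideal. Qed.

Lemma leavitt_act_bilinear : bilin leavitt_act.
Proof.
split=> [m|a k m n]; first exact/quot_lift_linear/free_act_ideal.
elim/quot_ind: a => a; rewrite !leavitt_actE.
exact: free_act_linear.
Qed.

Lemma leavitt_actA a b m : leavitt_act a (leavitt_act b m) = leavitt_act (a ** b) m.
Proof.
elim/quot_ind: a => a; elim/quot_ind: b => b.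
by rewrite /= qa_mulE !leavitt_actE free_actA.
Qed.

Definition leavitt_module : lmodule leavitt_nua :=
  LModule leavitt_act_bilinear leavitt_actA.

End Representation.
End Leavitt.

Section Induction.
Variables (K : fieldType) (E : digraph) (x : bpath E).

(* h = (mu p, |mu| - |nu| + k, x) where g = (nu p, k, x) *)
Definition mon_rel (mu nu : finpath E) (g h : Lset x) : Prop :=
  exists (p : bpath E) (hm : frng mu = bsrc p) (hn : frng nu = bsrc p),
    [/\ gpd_c g = bcat hn, gpd_c h = bcat hm &
        gpd_k h = (flen mu)%:Z - (flen nu)%:Z + gpd_k g].

Definition mon_fun (mu nu : finpath E) (g : Lset x) : {malg K[Lset x]} :=
  if pselect (exists h, mon_rel mu nu g h) is left e then << projT1 (cid e) >>
  else 0.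

Lemma mon_rel_fun mu nu g h h' : mon_rel mu nu g h -> mon_rel mu nu g h' -> h = h'.
Proof.
move=> [p [hm [hn [e1 e2 e3]]]] [p' [hm' [hn' [e1' e2' e3']]]].
have epp : p = p' by apply: (bcat_inj (hp := hn) (hq := hn')); rewrite -e1.
subst p'; apply: Lset_eq; last by rewrite e3.
by rewrite e2 e2' (Prop_irrelevance hm hm').
Qed.

Lemma mon_rel_sym mu nu g h : mon_rel mu nu g h -> mon_rel nu mu h g.
Proof.
move=> [p [hm [hn [e1 e2 e3]]]]; exists p, hn, hm; split=> //.
by rewrite e3 addrA -[X in X + _]addrA addKr subrr add0r.
Qed.

Variant mon_fun_spec mu nu g : {malg K[Lset x]} -> Type :=
| MonSome h of mon_rel mu nu g h : mon_fun_spec mu nu g << h >>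
| MonNone of (forall h, ~ mon_rel mu nu g h) : mon_fun_spec mu nu g 0.

Lemma mon_funP mu nu g : mon_fun_spec mu nu g (mon_fun mu nu g).
Proof.
rewrite /mon_fun; case: pselect => [e|ne]; last by constructor=> h hh; apply: ne; exists h.
by constructor; case: (cid e).
Qed.

Lemma mon_funE mu nu g h : mon_rel mu nu g h -> mon_fun mu nu g = << h >>.
Proof.
move=> hh; case: mon_funP => [h' hh'|/(_ h)//].
by rewrite (mon_rel_fun hh hh').
Qed.

Lemma mon_fun0 mu nu g : (forall h, ~ mon_rel mu nu g h) -> mon_fun mu nu g = 0.
Proof. by move=> nh; case: mon_funP => // h /nh. Qed.

Lemma mon_rel_ex mu nu (g : Lset x) (p : bpath E) (hm : frng mu = bsrc p) (hn : frng nu = bsrc p) :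
  gpd_c g = bcat hn -> exists h, mon_rel mu nu g h.
Proof.
move=> eg.
have t : tail_equiv ((flen mu)%:Z - (flen nu)%:Z) (bcat hm) (gpd_c g).
  by exists mu, nu, p, hm, hn; rewrite eg.
exists (@LElt _ x (Gpd (tail_equiv_trans t (gpdP g))) (L_d g)).
by exists p, hm, hn.
Qed.

Definition mon_op (mu nu : finpath E) : {linear {malg K[Lset x]} -> {malg K[Lset x]}} :=
  linext (mon_fun mu nu).

Lemma mon_opU mu nu g : mon_op mu nu << g >> = mon_fun mu nu g.
Proof. exact: linextU. Qed.

(* The generators v, e and e^* are the monomials v v^*, e r(e)^* and r(e) e^*. *)
Definition KL_gen (g : generator E) : {linear {malg K[Lset x]} -> {malg K[Lset x]}} :=
  match g with
  | GV v => mon_op (vpath v) (vpath v)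
  | GE e => mon_op (epath e) (vpath (erng e))
  | GS e => mon_op (vpath (erng e)) (epath e)
  end.

Arguments KL_gen : simpl never.

Lemma mon_relV v g h : mon_rel (vpath v) (vpath v) g h <-> g = h /\ bsrc (gpd_c g) = v.
Proof.
split=> [[p [hm [hn [e1 e2 e3]]]]|[<- <-]].
  split; first by apply: Lset_eq; rewrite ?e1 ?e2 ?e3 ?(Prop_irrelevance hm hn) // add0r.
  by rewrite e1 bsrc_bcat.
have hm : frng (vpath (bsrc (gpd_c g))) = bsrc (gpd_c g) by [].
by exists (gpd_c g), hm, hm; rewrite bcat_vpath subrr add0r.
Qed.

Lemma bcat_vpath' v (p : bpath E) (h : frng (vpath v) = bsrc p) : bcat h = p.
Proof. by have ev : v = bsrc p by []; subst v; exact: bcat_vpath. Qed.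

Lemma mon_relE mu g h : mon_rel mu (vpath (frng mu)) g h <->
  exists hm : frng mu = bsrc (gpd_c g),
    gpd_c h = bcat hm /\ gpd_k h = (flen mu)%:Z + gpd_k g.
Proof.
split=> [[p [hm [hn [e1 e2 e3]]]]|[hm [e2 e3]]].
  have ep : gpd_c g = p by rewrite e1 bcat_vpath'.
  by subst p; exists hm; rewrite e3 subr0.
by exists (gpd_c g), hm, hm; rewrite bcat_vpath' subr0.
Qed.

Lemma KL_genV v (g : Lset x) : KL_gen (GV v) << g >> = if bsrc (gpd_c g) == v then << g >> else 0.
Proof.
rewrite [LHS]mon_opU; case: eqP => ev; first by apply: mon_funE; exact/mon_relV.
by apply: mon_fun0 => h /mon_relV[].
Qed.

Lemma mon_rel_src mu nu g h : mon_rel mu nu g h ->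
  bsrc (gpd_c g) = fsrc nu /\ bsrc (gpd_c h) = fsrc mu.
Proof. by move=> [p [hm [hn [-> -> _]]]]; rewrite !bsrc_bcat. Qed.

Lemma mon_relE_ex mu (g : Lset x) : frng mu = bsrc (gpd_c g) ->
  exists h, mon_rel mu (vpath (frng mu)) g h.
Proof.
move=> hm; apply: (@mon_rel_ex mu (vpath (frng mu)) g (gpd_c g) hm hm).
by rewrite bcat_vpath'.
Qed.

Lemma mon_relE_edge e f g h h' :
  mon_rel (epath e) (vpath (erng e)) g h ->
  mon_rel (epath f) (vpath (erng f)) h' h -> e = f.
Proof.
move=> [p [hm [hn [_ e2 _]]]] [p' [hm' [hn' [_ e2' _]]]].
have := congr1 (fun y => bedge y 0%N) (etrans (esym e2) e2').
by rewrite !bedge_bcat /= => -[].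
Qed.

Lemma regular_edge (g : Lset x) v : bsrc (gpd_c g) = v -> ~ singular v ->
  exists e, exists2 h, esrc e = v & mon_rel (vpath (erng e)) (epath e) g h.
Proof.
move=> ev nsing.
have cons e (p : bpath E) (h : frng (epath e) = bsrc p) : gpd_c g = bcat h ->
    exists e, exists2 h, esrc e = v & mon_rel (vpath (erng e)) (epath e) g h.
  move=> eg; have [h' hh'] := @mon_rel_ex (vpath (erng e)) (epath e) g p h h eg.
  by exists e, h' => //; rewrite -ev eg bsrc_bcat.
case eg : (gpd_c g) ev => [mu hs|q] /= ev.
  case: mu hs eg ev => w [|e es] /= wk hs eg ev; first by case: nsing; rewrite -ev.
  have wk' : walk (erng e) es by have /andP[] := wk.
  have hs' : singular (frng (FinPath wk')) by [].
  have h : frng (epath e) = bsrc (BFin hs') by [].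
  apply: (cons e _ h); rewrite eg; apply: BFin_eq; apply: fpath_eq => //=.
  by have /andP[/eqP] := wk.
pose q' := @IPath _ (fun i => iedge q i.+1) (fun i => ipathP q i.+1).
have h : frng (epath (iedge q 0)) = bsrc (BInf q') by exact: ipathP.
apply: (cons _ _ h); rewrite eg; apply: bpath_eq => [|i]; first by rewrite bsrc_bcat.
by rewrite bedge_bcat; case: i => [|i] //=; rewrite subn1.
Qed.

Lemma KL_genE e g : KL_gen (GE e) << g >> = mon_fun (epath e) (vpath (erng e)) g.
Proof. exact: mon_opU. Qed.

Lemma KL_genS e g : KL_gen (GS e) << g >> = mon_fun (vpath (erng e)) (epath e) g.
Proof. exact: mon_opU. Qed.

Lemma KL_genP a m : leavitt_rel a -> free_act KL_gen m a = 0.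
Proof.
have genM g g' n : free_act KL_gen n (nua_mul (gen K g) (gen K g')) =
    KL_gen g (KL_gen g' n) by rewrite free_actA !free_act_gen.
move=> ra; have KL_genES := (KL_genE, KL_genS); suff : free_act KL_gen^~ a =1 (fun=> 0) by exact.
apply: linear_ext => [||g]; first exact: free_act_linear.
  by move=> k u w; rewrite scaler0 addr0.
case: ra => [v w|e|e|e|e|e f|v nsing]; rewrite linearB ?genM.
- rewrite KL_genV; case: eqP => [ew|nw].
    rewrite KL_genV ew; case: (eqVneq v w) => [->|nvw].
      by rewrite free_act_gen KL_genV ew eqxx subrr.
    by rewrite linear0 subrr.
  rewrite linear0; case: (eqVneq v w) => [->|nvw]; last by rewrite linear0 subrr.
  by rewrite free_act_gen KL_genV; case: eqP => //; rewrite subrr.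
- rewrite free_act_gen KL_genES; case: mon_funP => [h /mon_rel_src[_ eh]|_].
    by rewrite KL_genV eh eqxx subrr.
  by rewrite linear0 subrr.
- rewrite free_act_gen KL_genV.
  case: eqP => [_|ne]; first by rewrite subrr.
  rewrite linear0 KL_genES mon_fun0 ?subrr // => h /mon_rel_src[eg _].
  exact: ne.
- rewrite free_act_gen KL_genES; case: mon_funP => [h /mon_rel_src[_ eh]|_].
    by rewrite KL_genV eh eqxx subrr.
  by rewrite linear0 subrr.
- rewrite free_act_gen KL_genV.
  case: eqP => [_|ne]; first by rewrite subrr.
  rewrite linear0 KL_genES mon_fun0 ?subrr // => h /mon_rel_src[eg _].
  exact: ne.
- rewrite KL_genES; case: mon_funP => [h hh|nh].
    rewrite KL_genES; case: (eqVneq e f) => [ef|nef].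
      subst f; rewrite (mon_funE (mon_rel_sym hh)) free_act_gen KL_genV.
      by have [-> _] := mon_rel_src hh; rewrite eqxx subrr.
    rewrite mon_fun0 ?linear0 ?addr0 // => h' /mon_rel_sym hh'.
    by case/eqP: nef; exact: mon_relE_edge hh' hh.
  rewrite linear0; case: (eqVneq e f) => [ef|nef]; last by rewrite linear0 subrr.
  subst f; rewrite free_act_gen KL_genV; case: eqP => [eg|_]; last by rewrite subrr.
  by have [h /nh] := @mon_relE_ex (epath e) g (esym eg).
- have fv : finite_set (out_edges v).
    by apply: contrapT => inf; apply: nsing; right.
  rewrite fsbig_finite // (linear_sum (free_act (@KL_gen) << g >>)) free_act_gen KL_genV.
  under eq_bigr => e _ do rewrite genM.
  case: eqP => [eg|ng]; last first.
    rewrite big_seq big1 ?subrr // => e; rewrite in_fset_set // inE /out_edges /= => ev.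
    rewrite KL_genES mon_fun0 ?linear0 // => h /mon_rel_src[eg _].
    by apply: ng; rewrite eg.
  have [e [h ev hh]] := regular_edge eg nsing.
  rewrite (bigD1_seq e) /= ?fset_uniq //; last first.
    by rewrite in_fset_set // inE.
  rewrite KL_genES (mon_funE hh) KL_genES (mon_funE (mon_rel_sym hh)).
  rewrite big1 ?addr0 ?subrr // => f nfe; rewrite KL_genES mon_fun0 ?linear0 // => h' hh'.
  by case/eqP: nfe; exact: mon_relE_edge (mon_rel_sym hh') (mon_rel_sym hh).
Qed.

Definition KL_lmodule : lmodule (leavitt K E) := leavitt_module KL_genP.

Lemma KL_actU w m : lm_act (leavitt_word K w) m = word_op KL_gen w m :> KL_lmodule.
Proof. by rewrite /= leavitt_actE; [exact: free_actU | exact: KL_genP]. Qed.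

Definition KL_deg (n : int) : {malg K[Lset x]} -> Prop :=
  lspan (fun a => exists2 g : Lset x, gpd_k g = n & a = << g >>).

Definition KL_ract : {malg K[Lset x]} -> {malg K[isotropy x]} -> {malg K[Lset x]} :=
  linext2 (fun g h => << L_mul g h >>).

Lemma KL_ract_bilinear : bilin KL_ract.
Proof. exact: linext2_bilinear. Qed.

Lemma KL_ractUU g h : KL_ract << g >> << h >> = << L_mul g h >>.
Proof. exact: linext2UU. Qed.

Lemma KL_ractA m (b c : isotropy_algebra K x) :
  KL_ract (KL_ract m b) c = KL_ract m (nua_mul b c).
Proof.
have [ll lr] := KL_ract_bilinear.
have [ml mr] := nua_mul_bilinear (isotropy_algebra K x).
move: m; apply: linear_ext => [||g]; first exact: (linear_comp (ll c) (ll b)).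
  exact: ll.
move: b; apply: linear_ext => [||h].
- exact: (linear_comp (ll c) (lr << g >>)).
- exact: (linear_comp (lr << g >>) (ml c)).
move: c; apply: linear_ext => [||k].
- exact: lr.
- exact: (linear_comp (lr << g >>) (mr << h >>)).
by rewrite /= sga_mulUU !KL_ractUU L_mulA.
Qed.

Lemma mon_rel_ract mu nu g h (k : isotropy x) :
  mon_rel mu nu g h -> mon_rel mu nu (L_mul g k) (L_mul h k).
Proof.
move=> [p [hm [hn [e1 e2 e3]]]]; exists p, hm, hn; split=> //=.
by rewrite e3 addrA.
Qed.

Lemma mon_op_ract mu nu m b :
  mon_op mu nu (KL_ract m b) = KL_ract (mon_op mu nu m) b.
Proof.
have [ll lr] := KL_ract_bilinear.
have lin := @linearP _ _ _ _ (mon_op mu nu).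
move: m; apply: linear_ext => [||g]; first exact: (linear_comp lin (ll b)).
  exact: (linear_comp (ll b) lin).
move: b; apply: linear_ext => [||k]; first exact: (linear_comp lin (lr << g >>)).
  exact: lr.
rewrite KL_ractUU !mon_opU; case: (mon_funP _ _ g) => [h hh|nh].
  by rewrite (mon_funE (mon_rel_ract k hh)) KL_ractUU.
rewrite (linear_zero (ll _)) mon_fun0 // => h [p [hm [hn [e1 _ _]]]].
by have [h'] := @mon_rel_ex mu nu g p hm hn e1; exact: nh.
Qed.

Lemma KL_actC (a : leavitt K E) (m : KL_lmodule) (b : isotropy_algebra K x) :
  @lm_act _ _ KL_lmodule a (KL_ract m b) = KL_ract (@lm_act _ _ KL_lmodule a m) b.
Proof.
have [ll lr] := KL_ract_bilinear.
have [al ar] := lm_act_bilinear KL_lmodule.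
move: a; apply: leavitt_linear_ext => [||w]; first exact: al.
  exact: (linear_comp (ll b) (al m)).
rewrite !KL_actU /word_op; elim: (_ :: _) => [//|g gs IH] /=.
by rewrite IH; case: g => [v|e|e]; exact: mon_op_ract.
Qed.

Definition KL : grbimodule (leavitt K E) (isotropy_algebra K x) :=
  @GrBimodule K (leavitt K E) (isotropy_algebra K x) (@GrModule _ (leavitt K E) KL_lmodule KL_deg)
    KL_ract KL_ract_bilinear KL_ractA KL_actC.

Definition Ind (N : grmodule (isotropy_algebra K x)) : grmodule (leavitt K E) :=
  tensor_product KL N.

End Induction.

Section MonomialAction.
Variables (K : fieldType) (E : digraph) (x : bpath E).

Local Notation Rel mu := (@mon_rel E x mu (vpath (frng mu))).

Lemma Rel_cons v e es (w : walk v (e :: es)) (w' : walk (erng e) es) g h' :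
  Rel (FinPath w) g h' <-> exists2 h, Rel (FinPath w') g h & Rel (epath e) h h'.
Proof.
have main h k : Rel (FinPath w') g h -> Rel (epath e) h k -> Rel (FinPath w) g k.
  move=> /mon_relE[hm [e1 e2]] /mon_relE[hm' [e1' e2']]; apply/mon_relE.
  exists hm; split; last by rewrite e2' e2 addrA.
  rewrite e1'; apply: bpath_eq => [|i].
    by rewrite !bsrc_bcat /=; have /andP[/eqP] := w.
  rewrite !bedge_bcat e1 bedge_bcat /flen /=; case: i => [|i] //=.
  by rewrite subn1.
split=> [hh'|[h hh hh']]; last exact: main hh hh'.
have [hm _] := (mon_relE _ _ _).1 hh'.
have [h hh] := @mon_relE_ex _ _ (FinPath w') g hm.
have [_ /= eh] := mon_rel_src hh.
have [k hk] := @mon_relE_ex _ _ (epath e) h (esym eh).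
by exists h => //; rewrite (mon_rel_fun hh' (main _ _ hh hk)).
Qed.

Lemma word_opE (M : lmodType K) (rho : generator E -> {linear M -> M}) g0 gs m :
  gs != [::] -> word_op rho (word_of g0 gs) m = foldr (fun g m => rho g m) m gs.
Proof. by case: gs. Qed.

Lemma fpath_nil v (w : walk v [::]) : FinPath w = vpath v :> finpath E.
Proof. exact: fpath_eq. Qed.

Lemma KL_foldE v es (w : walk v es) (g : Lset x) : bsrc (gpd_c g) = walk_end v es ->
  foldr (fun g m => KL_gen K x g m) << g >> [seq GE e | e <- es] =
  mon_fun K (FinPath w) (vpath (walk_end v es)) g.
Proof.
elim: es v w => [|e es IH] v w ev.
  by rewrite fpath_nil (@mon_funE _ _ _ _ _ _ g) //; apply/mon_relV.
have w' : walk (erng e) es by have /andP[] := w.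
rewrite /= (IH _ w' ev).
have [h hh] := @mon_relE_ex _ _ (FinPath w') g (esym ev).
rewrite (mon_funE K hh) KL_genE.
have [_ /= eh] := mon_rel_src hh.
have [k hk] := @mon_relE_ex _ _ (epath e) h (esym eh).
have R : Rel (FinPath w) g k by apply/(Rel_cons w w'); exists h.
by rewrite (mon_funE K hk) (mon_funE K R).
Qed.

Lemma KL_act_path mu g :
  @lm_act _ _ (KL_lmodule K x) (leavitt_path K mu) << g >> =
  mon_fun K mu (vpath (frng mu)) g.
Proof.
rewrite KL_actU; case: mu => v es w; have [ev|nv] := eqVneq (bsrc (gpd_c g)) (walk_end v es).
  case: es w ev => [|e es] w ev; last by rewrite -(KL_foldE w ev).
  by rewrite fpath_nil /word_op /= KL_genV ev eqxx (@mon_funE _ _ _ _ _ _ g) //; apply/mon_relV.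
rewrite mon_fun0; last by move=> h /mon_rel_src[e _]; case/eqP: nv.
case: es w nv => [|e es] w nv; first by rewrite /word_op /= KL_genV (negbTE nv).
rewrite word_opE // [fedges _]/= lastI map_rcons foldr_rcons KL_genE mon_fun0; last first.
  move=> h /mon_rel_src[eg _]; case/eqP: nv.
  by rewrite eg /walk_end /= last_map.
by elim: (map _ _) => //= f fs ->; rewrite linear0.
Qed.

Lemma KL_foldS v es (w : walk v es) (h : Lset x) : bsrc (gpd_c h) = v ->
  foldr (fun g m => KL_gen K x g m) << h >> [seq GS e | e <- rev es] =
  mon_fun K (vpath (walk_end v es)) (FinPath w) h.
Proof.
elim: es v w h => [|e es IH] v w h ev.
  by rewrite fpath_nil (@mon_funE _ _ _ _ _ _ h) //; apply/mon_relV.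
have w' : walk (erng e) es by have /andP[] := w.
rewrite rev_cons map_rcons foldr_rcons KL_genS.
case: mon_funP => [h1 hh1|nh].
  have [_ eh1] := mon_rel_src hh1.
  rewrite (IH _ w' _ eh1); case: mon_funP => [g hg|ng].
    rewrite (@mon_funE _ _ _ _ _ _ g) //; apply: mon_rel_sym.
    by apply/(Rel_cons w w'); exists h1; exact: mon_rel_sym.
  rewrite mon_fun0 // => g /mon_rel_sym /(Rel_cons w w')[h2 R2 R2'].
  apply: (ng g); apply: mon_rel_sym.
  by rewrite (mon_rel_fun hh1 (mon_rel_sym R2')).
rewrite mon_fun0.
  by elim: (map _ _) => //= f fs ->; rewrite linear0.
by move=> g /mon_rel_sym /(Rel_cons w w')[h2 _ /mon_rel_sym]; exact: nh.
Qed.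

Lemma KL_act_ghost nu h :
  @lm_act _ _ (KL_lmodule K x) (leavitt_ghost K nu) << h >> =
  mon_fun K (vpath (frng nu)) nu h.
Proof.
rewrite KL_actU; case: nu => v [|e es] w.
  rewrite fpath_nil /word_op /= KL_genV; case: eqP => [ev|nv].
    by rewrite (@mon_funE _ _ _ _ _ _ h) //; apply/mon_relV.
  by rewrite mon_fun0 // => g /mon_relV[].
rewrite word_opE [fedges _]/=; last by rewrite rev_cons map_rcons; case: (map _ _).
have [ev|nv] := eqVneq (bsrc (gpd_c h)) v; first exact: KL_foldS.
rewrite mon_fun0; last by move=> g /mon_rel_src[eg _]; case/eqP: nv.
rewrite rev_cons map_rcons foldr_rcons KL_genS mon_fun0.
  by elim: (map _ _) => //= f fs ->; rewrite linear0.
move=> g /mon_rel_src[eg _]; case/eqP: nv.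
by rewrite eg /=; have /andP[/eqP] := w.
Qed.

Lemma KL_act_mon mu nu g : frng mu = frng nu ->
  @lm_act _ _ (KL_lmodule K x) (leavitt_mon K mu nu) << g >> = mon_fun K mu nu g.
Proof.
move=> emn; rewrite /leavitt_mon -lm_actA KL_act_ghost.
case: mon_funP => [h0 hh0|nh0].
  rewrite KL_act_path; have [eg eh0] := mon_rel_src hh0.
  have [h hh] := @mon_relE_ex _ _ mu h0 (etrans emn (esym eh0)).
  rewrite (mon_funE K hh) (@mon_funE _ _ _ _ _ _ h) //.
  have /mon_relE[hn [e1 e2]] := mon_rel_sym hh0.
  have /mon_relE[hm [e1' e2']] := hh.
  exists (gpd_c h0), hm, hn; split=> //.
  by rewrite e2' e2 addrA subrK.
rewrite linear_zero; last exact: (lm_act_bilinear (KL_lmodule K x)).2.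
rewrite mon_fun0 // => h [p [hm [hn [e1 e2 e3]]]].
have [h0] := @mon_rel_ex _ _ (vpath (frng nu)) nu g p hn hn e1.
exact: nh0.
Qed.

End MonomialAction.

Section Nvc.
Variables (K : fieldType) (E : digraph).

Local Notation "a ** b" := (nua_mul a b) (at level 40, left associativity).
Local Notation X g := (leavitt_word K ((g, [::]) : word E)).
Local Notation path_ := (leavitt_path K).
Local Notation ghost := (leavitt_ghost K).
Local Notation mon := (leavitt_mon K).

Lemma leavitt_gen g g' : X g ** X g' =
  to_quot (ideal (@leavitt_rel K E)) (gen K g ** gen K g').
Proof. by rewrite /= qa_mulE. Qed.

Lemma X_vw v w : X (GV v) ** X (GV w) = if v == w then X (GV v) else 0.
Proof.
rewrite leavitt_gen (leavitt_rel_eq (leavitt_vw K v w)).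
by case: eqP => // _; rewrite linear0.
Qed.
Lemma X_ck1 e f : X (GS e) ** X (GE f) = if e == f then X (GV (erng e)) else 0.
Proof.
rewrite leavitt_gen (leavitt_rel_eq (leavitt_ck1 K e f)).
by case: eqP => // _; rewrite linear0.
Qed.
Lemma X_se e : X (GV (esrc e)) ** X (GE e) = X (GE e).
Proof. by rewrite leavitt_gen (leavitt_rel_eq (leavitt_se K e)). Qed.
Lemma X_er e : X (GE e) ** X (GV (erng e)) = X (GE e).
Proof. by rewrite leavitt_gen (leavitt_rel_eq (leavitt_er K e)). Qed.
Lemma X_rs e : X (GV (erng e)) ** X (GS e) = X (GS e).
Proof. by rewrite leavitt_gen (leavitt_rel_eq (leavitt_rs K e)). Qed.
Lemma X_ss e : X (GS e) ** X (GV (esrc e)) = X (GS e).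
Proof. by rewrite leavitt_gen (leavitt_rel_eq (leavitt_ss K e)). Qed.
Lemma lmul0 (a : leavitt_nua K E) : a ** 0 = 0.
Proof. exact: linear_zero ((nua_mul_bilinear _).2 a). Qed.
Lemma mul0l (a : leavitt_nua K E) : 0 ** a = 0.
Proof. exact: linear_zero ((nua_mul_bilinear _).1 a). Qed.

Lemma path_nil v : path_ (vpath v) = X (GV v). Proof. by []. Qed.
Lemma ghost_nil v : ghost (vpath v) = X (GV v). Proof. by []. Qed.

Opaque leavitt_nua leavitt_word.

Lemma path_cons v e es (w : walk v (e :: es)) (w' : walk (erng e) es) :
  path_ (FinPath w) = X (GE e) ** path_ (FinPath w').
Proof.
case: es w w' => [|f es] w w'; first by rewrite fpath_nil path_nil X_er.
by rewrite /leavitt_path leavitt_wordM.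
Qed.

Lemma ghost_cons v e es (w : walk v (e :: es)) (w' : walk (erng e) es) :
  ghost (FinPath w) = ghost (FinPath w') ** X (GS e).
Proof.
case: (lastP es) w w' => [|s f] w w'; first by rewrite fpath_nil ghost_nil X_rs.
rewrite /leavitt_ghost leavitt_wordM /= rev_cons !rev_rcons /=.
by rewrite /mul /= /word_mul /= map_rcons -cats1.
Qed.

Lemma X_path v mu :
  X (GV v) ** path_ mu = if v == fsrc mu then path_ mu else 0.
Proof.
case: mu => u [|e es] w; first by rewrite fpath_nil path_nil X_vw; case: eqP => [->|].
have w' : walk (erng e) es by have /andP[] := w.
have eu : esrc e = u by have /andP[/eqP] := w.
rewrite (path_cons w w') [fsrc _]/= -eu nua_mulA -{1}(X_se e) nua_mulA X_vw.
by case: eqP => [->|_]; rewrite ?X_se // !mul0l.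
Qed.

Lemma ghost_X nu : ghost nu ** X (GV (fsrc nu)) = ghost nu.
Proof.
case: nu => u [|e es] w; first by rewrite fpath_nil ghost_nil X_vw eqxx.
have w' : walk (erng e) es by have /andP[] := w.
have eu : esrc e = u by have /andP[/eqP] := w.
by rewrite (ghost_cons w w') [fsrc _]/= -eu -nua_mulA X_ss.
Qed.

Lemma walk_rcons (v : vertex E) es e :
  walk v (rcons es e) = walk v es && (esrc e == walk_end v es).
Proof. by rewrite -cats1 walk_cat /= andbT. Qed.

Lemma X_ghost e nu : esrc e = frng nu ->
  exists nu', [/\ frng nu' = erng e, fsrc nu' = fsrc nu & X (GS e) ** ghost nu = ghost nu'].
Proof.
case: nu => v es w ev.
have w' : walk v (rcons es e) by rewrite walk_rcons w; apply/eqP.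
exists (FinPath w'); split=> //; first by rewrite /frng /walk_end /= map_rcons last_rcons.
have -> : ghost (FinPath w') = leavitt_word K ((GS e, [seq GS f | f <- rev es]) : word E).
  by rewrite /leavitt_ghost /= rev_rcons.
case: (lastP es) w ev {w'} => [|s f] w ev.
  by have ev' : esrc e = v by []; subst v; rewrite fpath_nil ghost_nil X_ss.
by rewrite /leavitt_ghost leavitt_wordM /= rev_rcons.
Qed.

(* Left multiplication by a generator maps a monomial to a monomial or to 0. *)
Lemma gen_mon g mu nu : frng mu = frng nu ->
  X g ** mon mu nu = 0 \/ exists mu' nu',
    [/\ frng mu' = frng nu', fsrc nu' = fsrc nu & X g ** mon mu nu = mon mu' nu'].
Proof.
move=> emn; rewrite /leavitt_mon nua_mulA; case: g => [v|e|e].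
- rewrite X_path; case: eqP => _; last by left; rewrite mul0l.
  by right; exists mu, nu.
- have [ev|nv] := eqVneq (erng e) (fsrc mu).
    case: mu emn ev => u es w emn /= ev; subst u.
    have w' : walk (esrc e) (e :: es) by rewrite /= eqxx.
    by right; exists (FinPath w'), nu; rewrite (path_cons w' w).
  have -> : X (GE e) ** path_ mu = X (GE e) ** (X (GV (erng e)) ** path_ mu).
    by rewrite nua_mulA X_er.
  by left; rewrite X_path (negbTE nv) lmul0 mul0l.
case: mu emn => u [|f es] w emn.
  rewrite fpath_nil path_nil.
  have [eu|nu'] := eqVneq (esrc e) u; last first.
    have -> : X (GS e) ** X (GV u) = X (GS e) ** (X (GV (esrc e)) ** X (GV u)).
      by rewrite nua_mulA X_ss.
    by left; rewrite X_vw (negbTE nu') lmul0 mul0l.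
  rewrite -eu X_ss; right.
  have [nu' [h1 h2 h3]] := X_ghost (etrans eu emn).
  exists (vpath (erng e)), nu'; split; [by rewrite h1|exact: h2|].
  by rewrite path_nil -h3 nua_mulA X_rs.
have w' : walk (erng f) es by have /andP[] := w.
rewrite (path_cons w w') nua_mulA X_ck1; case: eqP => [->|_]; last first.
  by left; rewrite !mul0l.
by right; exists (FinPath w'), nu; rewrite X_path /= eqxx.
Qed.

Transparent leavitt_nua leavitt_word.

Variable v : vertex E.

Definition Nvc_mon (a : leavitt_nua K E) : Prop :=
  exists mu nu, [/\ frng mu = frng nu, fsrc nu = v & a = mon mu nu].

Definition Nvc_sub : subspaceOf (leavitt_nua K E) := spanOf Nvc_mon.

Lemma Nvc_mull a b : Nvc_sub b -> Nvc_sub (a ** b).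
Proof.
have [al ar] := nua_mul_bilinear (leavitt_nua K E).
have sub (c : leavitt_nua K E) : subspace (fun b => Nvc_sub (c ** b)).
  split=> [|k y z hy hz]; first by rewrite lmul0; exact: sub0P.
  by rewrite ar; exact: sub_linP.
have gen_mull g c : Nvc_sub c -> Nvc_sub (X g ** c).
  move=> hc; apply: (span_sub (sub (X g)) _ hc) => _ [mu [nu [h1 h2 ->]]].
  have [->|[mu' [nu' [h1' h2' ->]]]] := gen_mon g h1; first exact: sub0P.
  by apply: span_gen; exists mu', nu'; rewrite h2'.
have word_mull w c : Nvc_sub c -> Nvc_sub (leavitt_word K w ** c).
  case: w => g gs; elim: gs g => [|g' gs IH] g hc; first exact: gen_mull.
  have -> : leavitt_word K ((g, g' :: gs) : word E) = X g ** leavitt_word K (g', gs).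
    by rewrite leavitt_wordM.
  by rewrite -nua_mulA; exact: gen_mull (IH g' hc).
move=> hb; pose q (c : free_alg K E) : leavitt_nua K E := to_quot (ideal (@leavitt_rel K E)) c.
have lq : linear (fun c => q c ** b) := linear_comp (al b) (to_quot_linear _).
suff : forall c, Nvc_sub (q c ** b) by elim/quot_ind: a.
apply: (malg_span (W := fun c => Nvc_sub (q c ** b))) => [|w]; last exact: word_mull.
split=> [|k y z hy hz]; first by rewrite (linear_zero lq); exact: sub0P.
by apply: (eq_ind_r (sub_pred Nvc_sub) _ (lq k y z)); exact: sub_linP.
Qed.

(* N_vc = L_K(E) v *)
Lemma Nvc_subE a : Nvc_sub a <-> exists b, a = b ** X (GV v).
Proof.
have [al ar] := nua_mul_bilinear (leavitt_nua K E).
split=> [|[b ->]]; last first.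
  apply: Nvc_mull; apply: span_gen; exists (vpath v), (vpath v); split=> //.
  by rewrite /leavitt_mon path_nil ghost_nil X_vw eqxx.
elim=> [_ [mu [nu [_ <- ->]]]||k y z _ [b ->] _ [c ->]].
- by exists (mon mu nu); rewrite /leavitt_mon -nua_mulA ghost_X.
- by exists 0; rewrite mul0l.
- by exists (k *: b + c); exact: esym (al (X (GV v)) k b c).
Qed.

Definition Nvc_act (a : leavitt_nua K E) (m : subsp Nvc_sub) : subsp Nvc_sub :=
  to_subsp (Nvc_mull a (subspP m)).

Lemma Nvc_act_bilinear : bilin Nvc_act.
Proof.
have vP k m n : val (k *: m + n : subsp Nvc_sub) = k *: val m + val n by rewrite linearP.
split=> [m k a b|a k m n]; apply: val_inj; rewrite vP.
  exact: (nua_mul_bilinear (leavitt_nua K E)).1 (val m) k a b.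
apply: etrans ((nua_mul_bilinear (leavitt_nua K E)).2 a k (val m) (val n)).
exact: (congr1 (fun t => a ** t) (vP k m n)).
Qed.

Lemma Nvc_actA a b m : Nvc_act a (Nvc_act b m) = Nvc_act (a ** b) m.
Proof. by apply: val_inj; exact: nua_mulA. Qed.

Definition Nvc_deg (n : int) (m : subsp Nvc_sub) : Prop :=
  lspan (fun a => exists mu nu, [/\ frng mu = frng nu, fsrc nu = v,
    (flen mu)%:Z - (flen nu)%:Z = n & a = mon mu nu]) (val m).

Definition Nvc : grmodule (leavitt K E) :=
  @GrModule _ (leavitt K E)
    (@LModule _ (leavitt K E) _ _ Nvc_act_bilinear Nvc_actA) Nvc_deg.

End Nvc.

Section Cycles.
Variable E : digraph.

Definition is_cycle (c : finpath E) : Prop :=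
  [/\ (0 < flen c)%N, fsrc c = frng c & uniq [seq esrc e | e <- fedges c]].

Definition is_exit (c : finpath E) (e : edge E) : Prop :=
  exists2 f, f \in fedges c & esrc e = esrc f /\ e <> f.

Definition without_exits (c : finpath E) : Prop := forall e, ~ is_exit c e.

Section Infinite.
Variables (c : finpath E) (hc : is_cycle c).

Lemma cycle_pos : (0 < flen c)%N. Proof. by case: hc. Qed.

Definition cycle_edge (i : nat) : edge E :=
  tnth (in_tuple (fedges c)) (Ordinal (ltn_pmod i cycle_pos)).

Lemma cycle_edgeP i : erng (cycle_edge i) = esrc (cycle_edge i.+1).
Proof.
have [_ closed _] := hc; pose d := cycle_edge 0.
rewrite /cycle_edge !(tnth_nth d) /=.
have lti := ltn_pmod i cycle_pos.
have -> : (i.+1 %% flen c = if (i %% flen c).+1 == flen c then 0 else (i %% flen c).+1)%N.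
  rewrite -addn1 -modnDml addn1; case: eqP => [->|ne]; first by rewrite modnn.
  by rewrite modn_small // ltn_neqAle lti andbT; apply/eqP.
case: eqP => [el|ne].
  rewrite (walk_nth0 d (fpathP c) cycle_pos) closed /frng.
  by rewrite (walk_end_nth _ d cycle_pos) -/(flen c) -(congr1 predn el).
by apply: (walk_nth d (fpathP c)); rewrite ltn_neqAle lti andbT; apply/eqP.
Qed.

(* c^oo = ccc... *)
Definition cycle_inf : bpath E := BInf (IPath cycle_edgeP).

End Infinite.
End Cycles.

(* Main.v *)
(** Both modules are isomorphic to [K L_x] for [x = c^oo]. For the induced module
    this is [M (x)_B B = M]. For [N_vc = L_K(E) v] the map is [a |-> a (x, 0, x)]:
    it sends every [mu nu^*] with [s(nu) = v] to an element of the basis [L_x],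
    since [nu] is a prefix of [c^oo]; two monomials have the same image only if
    they extend a common one by paths [k] on the cycle, and [k k^* = s(k)] by
    (CK2) because the cycle has no exits.

    [K L_x] is graded simple: the elements in the support of a homogeneous
    element are [(y, k, x)] with the same [k], hence with distinct [y], so that
    [p p^*] kills all but one of them if [p] is a long enough prefix of its [y];
    and any basis element is mapped to any other one by a monomial. *)

Require Import Defs.
From mathcomp Require Import all_boot all_algebra.
From mathcomp Require Import finmap boolp classical_sets cardinality fsbigop monalg.

Set Implicit Arguments.
Unset Strict Implicit.
Unset Printing Implicit Defensive.

Import GRing.Theory.
Local Open Scope ring_scope.

(** * Linear maps and spanning sets *)

Section Linear.
Variables (K : fieldType) (U V : lmodType K).

Lemma linear_bigsum (I : Type) (f : U -> V) (s : seq I) (F : I -> U) :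
  linear f -> f (\sum_(i <- s) F i) = \sum_(i <- s) f (F i).
Proof.
move=> lf; apply: big_morph; last exact: linear_zero.
by move=> a b; have := lf 1 a b; rewrite !scale1r.
Qed.

Lemma linear_scale (f : U -> V) k a : linear f -> f (k *: a) = k *: f a.
Proof. by move=> lf; rewrite -[k *: a]addr0 lf (linear_zero lf) addr0. Qed.

Lemma cancel_linear (f : U -> V) (g : V -> U) :
  cancel f g -> cancel g f -> linear f -> linear g.
Proof. by move=> fK gK lf k a b; rewrite -[RHS]fK lf !gK. Qed.

Lemma subspace_preim (f : U -> V) (W : V -> Prop) :
  linear f -> subspace W -> subspace (fun u => W (f u)).
Proof.
move=> lf [W0 Wl]; split=> [|k a b Wa Wb]; first by rewrite (linear_zero lf).
by rewrite lf; exact: Wl.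
Qed.

(** Homogeneous components are given as spans, so a degree condition on the values of a linear map
    needs checking on spanning elements only. *)
Lemma lspan_preim (f : U -> V) (S : U -> Prop) (W : V -> Prop) : linear f ->
  subspace W -> (forall u, S u -> W (f u)) -> forall u, lspan S u -> W (f u).
Proof. by move=> lf sW SW; exact: span_sub (subspace_preim lf sW) SW. Qed.

Lemma eq_on_lspan (f g : U -> V) (S : U -> Prop) : linear f -> linear g ->
  (forall u, S u -> f u = g u) -> forall u, lspan S u -> f u = g u.
Proof.
move=> lf lg; apply: span_sub; split; first by rewrite !linear_zero.
by move=> k a b ea eb; rewrite lf lg ea eb.
Qed.

End Linear.

Lemma linext_id (K : fieldType) (X : choiceType) (m : {malg K[X]}) :
  linext (fun y => << y >>) m = m.
Proof.
move: m; apply: (linear_ext (g := fun m => m)) => //; first exact: linearP.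
by move=> y; rewrite linextU.
Qed.

(** * Transport of structure along graded isomorphisms *)

Section GradedIso.
Variables (K : fieldType) (A : gralgebra K).
Implicit Types M N P : grmodule A.

(** The reverse implication on degrees comes from degree preservation by the inverse [g]. *)
Lemma graded_isomorphicI M N (f : M -> N) (g : N -> M) :
  linear f -> cancel f g -> cancel g f ->
  (forall a x, f (lm_act a x) = lm_act a (f x)) ->
  (forall n x, grm_deg n x -> grm_deg n (f x)) ->
  (forall n y, grm_deg n y -> grm_deg n (g y)) ->
  graded_isomorphic M N.
Proof.
move=> lf fK gK fa fd gd; exists f; split=> //; first by exists g.
by move=> n x; split=> [/fd//|/gd]; rewrite fK.
Qed.

Lemma graded_isomorphic_sym M N : graded_isomorphic M N -> graded_isomorphic N M.
Proof.
move=> [f [lf [g fK gK] fa fd]].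
apply: (graded_isomorphicI (cancel_linear fK gK lf) gK fK).
- by move=> a y; rewrite -[RHS]fK fa gK.
- by move=> n y; rewrite -{1}[y]gK => /fd.
- by move=> n x /fd.
Qed.

Lemma graded_isomorphic_trans M N P :
  graded_isomorphic M N -> graded_isomorphic N P -> graded_isomorphic M P.
Proof.
move=> [f [lf bf fa fd]] [g [lg bg ga gd]]; exists (fun x => g (f x)); split.
- exact: linear_comp.
- exact: bij_comp.
- by move=> a x; rewrite fa ga.
- by move=> n x; rewrite fd gd.
Qed.

Lemma graded_simple_iso M N :
  graded_isomorphic M N -> graded_simple N -> graded_simple M.
Proof.
move=> [f [lf [g fK gK] fa fd]] [[Nsub Ndec Nuniq Nact] [y0 y0N] Nsimple].
have lg := cancel_linear fK gK lf.
have f0 := linear_zero lf; have g0 := linear_zero lg.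
have gd n y : grm_deg n y <-> grm_deg n (g y) by rewrite fd gK.
have ga a y : g (lm_act a y) = lm_act a (g y) by rewrite -[RHS]fK fa gK.
split; first split.
- move=> n; have [h0 hl] := subspace_preim lf (Nsub n); split; first exact/fd.
  by move=> k a b /fd ha /fd hb; apply/fd; exact: hl.
- move=> x; have [s [F [Fd e]]] := Ndec (f x).
  exists s, (fun n => g (F n)); split=> [n|]; first exact/gd.
  by rewrite -(linear_bigsum _ _ lg) -e fK.
- move=> s F us Fd e n ns; apply: (can_inj fK); rewrite f0.
  apply: (Nuniq s (fun n => f (F n)) us) => // [m|]; first exact/fd.
  by rewrite -(linear_bigsum _ _ lf) e f0.
- by move=> m n a x ha /fd hx; apply/fd; rewrite fa; exact: Nact.
- by exists (g y0) => e; apply: y0N; rewrite -[y0]gK e f0.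
move=> U [Us Ua Ud].
(* The image of [U] under [f] is expressed as its preimage under the inverse [g]. *)
have [|Uy|Uy] := Nsimple (fun y => U (g y)).
- split; first exact: subspace_preim.
    by move=> a y; rewrite ga; exact: Ua.
  move=> y /Ud[s [F [Fd e]]]; exists s, (fun n => f (F n)); split.
    by move=> n; have [] := Fd n; rewrite fK -fd.
  by rewrite -(linear_bigsum _ _ lf) -e gK.
- by left=> x; rewrite -{1}[x]fK => /Uy fx; rewrite -[x]fK fx.
- by right=> x; rewrite -[x]fK; exact: Uy.
Qed.

End GradedIso.

(** * Prefixes and shifts of infinite paths *)

Section PathExtra.
Variable E : digraph.

Lemma bcat_inj_path (mu nu : finpath E) p q (hp : frng mu = bsrc p) (hq : frng nu = bsrc q) :
  flen mu = flen nu -> bcat hp = bcat hq -> mu = nu.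
Proof.
move=> el e; apply: fpath_eq; first by rewrite -(bsrc_bcat hp) e bsrc_bcat.
apply: eq_from_onth => i; have := congr1 (fun y => bedge y i) e; rewrite !bedge_bcat -el.
case: ltnP => // le _; rewrite !onth_default //.
by rewrite -/(flen nu) -el.
Qed.

Variable q : ipath E.

Lemma iprefix_walk i n : walk (esrc (iedge q i)) [seq iedge q j | j <- iota i n].
Proof. by elim: n i => //= n IH i; rewrite eqxx ipathP IH. Qed.

Lemma iprefix_end i n :
  walk_end (esrc (iedge q i)) [seq iedge q j | j <- iota i n] = esrc (iedge q (i + n)).
Proof.
elim: n i => [|n IH] i /=; first by rewrite addn0.
by rewrite /walk_end /= ipathP -[last _ _]/(walk_end _ _) IH addSnnS.
Qed.

Definition iprefix (n : nat) : finpath E := FinPath (iprefix_walk 0 n).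
(** The index [n + i.+1] is not convertible to [(n + i).+1], hence the transport along [addnS]. *)
Definition ishift (n : nat) : ipath E :=
  @IPath _ (fun i => iedge q (n + i))
    (fun i => etrans (ipathP q _) (congr1 (fun j => esrc (iedge q j)) (esym (addnS n i)))).

Lemma flen_iprefix n : flen (iprefix n) = n.
Proof. by rewrite /flen size_map size_iota. Qed.

Lemma iprefix_cat n : exists h : frng (iprefix n) = bsrc (BInf (ishift n)),
  BInf q = bcat h.
Proof.
have h : frng (iprefix n) = bsrc (BInf (ishift n)).
  by rewrite /frng iprefix_end /= addn0.
exists h; apply: bpath_eq => [|i]; first by rewrite bsrc_bcat.
rewrite bedge_bcat flen_iprefix; case: ltnP => lt /=.
  by rewrite onthE -map_comp (nth_map 0%N) ?size_iota // nth_iota.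
by rewrite subnKC.
Qed.

Lemma iprefix_bedge n p (h : frng (iprefix n) = bsrc p) i :
  (i < n)%N -> bedge (bcat h) i = Some (iedge q i).
Proof.
move=> lt; rewrite bedge_bcat flen_iprefix lt onthE /= -map_comp.
by rewrite (nth_map 0%N) ?size_iota // nth_iota.
Qed.

(** A finite common tail would make [BInf q] finite. Hence for infinite [x] every element of
    [Lset x] has an infinite path as its [gpd_c]. *)
Lemma tail_equiv_inf k y : tail_equiv k y (BInf q) -> exists q', y = BInf q'.
Proof. by move=> [mu [nu [[p hs|p] [hm [hn [-> e _]]]]]] //; exists (icat hm). Qed.

End PathExtra.

(** * The grading of $K L_x$ and transitivity of the monomials on its basis *)

Section KLmodule.
Variables (K : fieldType) (E : digraph) (x : bpath E).
Local Notation KLx := (KL K x).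
Local Notation act := (@lm_act K (leavitt K E) (KL_lmodule K x)).

Lemma KL_act_linear a : linear (act a).
Proof. exact: (lm_act_bilinear (KL_lmodule K x)).2. Qed.

Lemma KL_act_linearl m : linear (act^~ m).
Proof. exact: (lm_act_bilinear (KL_lmodule K x)).1. Qed.

Lemma KL_act_sum a (m : {malg K[Lset x]}) :
  act a m = \sum_(g <- msupp m) m@_g *: (act a << g >> : {malg K[Lset x]}).
Proof.
rewrite -{1}(linext_id m).
apply: etrans (linear_bigsum _ _ (KL_act_linear a)) _.
by apply: eq_bigr => g _; exact: linear_scale (KL_act_linear a).
Qed.

Definition KL_proj (n : int) : {linear {malg K[Lset x]} -> {malg K[Lset x]}} :=
  linext (fun g : Lset x => if gpd_k g == n then << g >> else 0).

Lemma KL_projU n g : KL_proj n << g >> = if gpd_k g == n then << g >> else 0.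
Proof. exact: linextU. Qed.

Lemma KL_deg_subspace n : subspace (@KL_deg K E x n).
Proof. exact: span_subspace. Qed.

Lemma KL_proj_deg n m : KL_deg n (KL_proj n m).
Proof.
move: m; apply: malg_span => [|g].
  exact: subspace_preim (linearP _) (KL_deg_subspace n).
rewrite KL_projU; case: eqP => [e|_]; last exact: (KL_deg_subspace n).1.
by apply: span_gen; exists g.
Qed.

Lemma KL_proj_id n p m : KL_deg n m -> KL_proj p m = if p == n then m else 0.
Proof.
have lin : linear (fun m : {malg K[Lset x]} => if p == n then m else 0).
  by case: (p == n) => // k a b; rewrite scaler0 addr0.
apply: (eq_on_lspan (linearP (KL_proj p)) lin) => _ [g <- ->].
by rewrite KL_projU eq_sym.
Qed.

Lemma KL_proj_sum (m : {malg K[Lset x]}) :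
  m = \sum_(n <- undup [seq gpd_k g | g : Lset x <- msupp m]) KL_proj n m.
Proof.
(* After the exchange of sums, a basis element [g] survives only in its own degree [gpd_k g], which
   [undup] lists once. *)
rewrite -[LHS]linext_id exchange_big /linext /=; apply: eq_big_seq => g gm.
rewrite -scaler_sumr (bigD1_seq (gpd_k g)) ?undup_uniq //=; last first.
  by rewrite mem_undup; apply: map_f.
by rewrite eqxx big1 ?addr0 // => n; rewrite eq_sym => /negbTE->.
Qed.

Lemma KL_graded : graded KLx.
Proof.
split.
- exact: KL_deg_subspace.
- move=> m; exists (undup [seq gpd_k g | g : Lset x <- msupp (m : {malg K[Lset x]})]).
  exists (fun n => KL_proj n m); split; last exact: KL_proj_sum.
  by move=> n; exact: KL_proj_deg.
(* Projecting the relation to degree [n] leaves only [F n]. *)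
- move=> s F us Fd e n ns; have := congr1 (KL_proj n) e.
  rewrite linear_sum linear0 (bigD1_seq n) //= (KL_proj_id _ (Fd n)) eqxx.
  rewrite big1 ?addr0 // => p npn.
  by rewrite (KL_proj_id _ (Fd p)) eq_sym (negbTE npn).
- move=> m n a y ha hy.
  apply: (lspan_preim (KL_act_linearl y) (KL_deg_subspace (m + n)) _ ha).
  move=> _ [mu [nu [emn <- ->]]].
  apply: (lspan_preim (KL_act_linear _) (KL_deg_subspace _) _ hy) => _ [g <- ->].
  rewrite KL_act_mon //; case: mon_funP => [h [p [hm [hn [_ _ <-]]]]|_].
    by apply: span_gen; exists h.
  exact: (KL_deg_subspace _).1.
Qed.

(** The product [h g^-1] is defined because both elements end in [x]; the two prefixes that witness
    its tail equivalence are [mu] and [nu]. *)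
Lemma mon_rel_trans_ex (g h : Lset x) : exists mu nu, mon_rel mu nu g h.
Proof.
have e : gpd_d h = gpd_c (gpd_inv g) by rewrite /= !L_d.
have [mu [nu [p [hm [hn [e1 e2 e3]]]]]] := gpdP (gpd_mul e).
exists mu, nu, p, hm, hn; split=> //.
by move: e3 => /= <-; rewrite subrK.
Qed.

Lemma mon_rel_rng mu nu (g h : Lset x) : mon_rel mu nu g h -> frng mu = frng nu.
Proof. by move=> [p [hm [hn _]]]; rewrite hm hn. Qed.

Lemma KL_act_rel mu nu (g h : Lset x) : mon_rel mu nu g h ->
  act (leavitt_mon K mu nu) << g >> = << h >>.
Proof. by move=> r; rewrite KL_act_mon ?(mon_rel_rng r) // (mon_funE K r). Qed.

(** Since monomials connect any two basis elements, a single one generates the module. *)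
Lemma KL_sub_full (U : KLx -> Prop) (g : Lset x) :
  subspace U -> (forall a m, U m -> U (lm_act a m)) -> U << g >> -> forall m, U m.
Proof.
move=> Us Ua Ug; apply: (malg_span Us) => h.
have [mu [nu r]] := mon_rel_trans_ex g h.
by rewrite -(KL_act_rel r); exact: Ua.
Qed.

End KLmodule.

(** * Graded simplicity of $K L_x$ for an infinite path $x$ *)

Section Infinite.
Variables (K : fieldType) (E : digraph) (q0 : ipath E).
Local Notation x := (BInf q0).
Local Notation act := (@lm_act K (leavitt K E) (KL_lmodule K x)).
Local Notation pp q n := (leavitt_mon K (iprefix q n) (iprefix q n)).

Lemma iprefix_fix (q : ipath E) n (g : Lset x) : gpd_c g = BInf q ->
  act (pp q n) << g >> = << g >>.
Proof.
move=> eg; have [h e] := iprefix_cat q n; apply: KL_act_rel.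
by exists (BInf (ishift q n)), h, h; rewrite eg subrr add0r.
Qed.

(** Elements of [Lset x] of equal degree can differ only in [gpd_c]. Here these are two infinite
    paths, which disagree at some index [i]; a prefix of [q] of length at least [i.+1] contains that
    edge, so it is not a prefix of the path of [h]. *)
Lemma iprefix_kill (q : ipath E) (g h : Lset x) : gpd_c g = BInf q ->
  gpd_k h = gpd_k g -> h <> g ->
  exists n0, forall n, (n0 <= n)%N -> act (pp q n) << h >> = 0.
Proof.
move=> eg ek ne.
have th : tail_equiv (gpd_k h) (gpd_c h) x by rewrite -[X in tail_equiv _ _ X](L_d h); exact: gpdP.
have [q' eh] := tail_equiv_inf th.
have [i ni] : exists i, iedge q' i <> iedge q i.
  apply/existsNP => ee; apply: ne; apply: Lset_eq => //; rewrite eg eh.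
  by apply: bpath_eq => [|i] /=; rewrite ee.
exists i.+1 => n lt; rewrite KL_act_mon // mon_fun0 // => k [p [hm [hn [e _ _]]]].
apply: ni; have := congr1 (fun y => bedge y i) (etrans (esym eh) e).
by rewrite iprefix_bedge // => -[].
Qed.

(** Bounds valid for all larger [n] can be combined by a maximum over the finite list [s]. *)
Lemma iprefix_isolate (q : ipath E) (g : Lset x) (s : seq (Lset x)) :
  gpd_c g = BInf q -> (forall h, h \in s -> gpd_k h = gpd_k g) ->
  exists n0, forall n, (n0 <= n)%N ->
    forall h, h \in s -> h != g -> act (pp q n) << h >> = 0.
Proof.
move=> eg; elim: s => [|h s IH] hs; first by exists 0%N.
have [|n1 H1] := IH; first by move=> k ks; apply: hs; rewrite inE ks orbT.
have [eh|ne] := eqVneq h g.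
  exists n1 => n le k; rewrite inE => /orP[/eqP->|/(H1 n le)//].
  by rewrite eh eqxx.
have [|n2 H2] := iprefix_kill eg (hs h _) (elimN eqP ne); first by rewrite inE eqxx.
exists (maxn n1 n2) => n; rewrite geq_max => /andP[le1 le2] k.
by rewrite inE => /orP[/eqP-> _|/(H1 n le1)//]; exact: H2.
Qed.

(** If [g] had another degree, the coefficient at [g] would be a linear form vanishing on all basis
    elements of degree [n], hence at [m]. The type [K^o] is $K$ as a module over itself. *)
Lemma KL_deg_supp n (m : {malg K[Lset x]}) (g : Lset x) :
  KL_deg n m -> g \in msupp m -> gpd_k g = n.
Proof.
move=> md; rewrite -mcoeff_neq0 => gm; apply: contrapT => /eqP ne; move/eqP: gm; apply.
have lz : linear (fun _ : {malg K[Lset x]} => 0 : K^o) by move=> k a b; rewrite scaler0 addr0.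
have lc : linear (fun m : {malg K[Lset x]} => m@_g : K^o).
  by move=> k a b; rewrite mcoeffD mcoeffZ.
apply: (eq_on_lspan lc lz _ md) => _ [h eh ->].
by rewrite mcoeffU; case: eqP => // e; rewrite -eh e eqxx in ne.
Qed.

Lemma KL_isolate n (m : {malg K[Lset x]}) : KL_deg n m -> m <> 0 ->
  exists (g : Lset x) a, act a m = << g >>.
Proof.
move=> md mn0.
have [g gm] : exists g, g \in msupp m.
  apply: contrapT => H; apply: mn0; apply/malgP => g; rewrite mcoeff0.
  by apply: mcoeff_outdom; apply/negP => gm; apply: H; exists g.
have tg : tail_equiv (gpd_k g) (gpd_c g) x by rewrite -[X in tail_equiv _ _ X](L_d g); exact: gpdP.
have [q eg] := tail_equiv_inf tg.
have [|n0 H] := iprefix_isolate (s := msupp m) eg.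
  by move=> h hm; rewrite (KL_deg_supp md hm) (KL_deg_supp md gm).
(* The monomial reduces [m] to its term at [g], and the scalar normalises the remaining
   coefficient. *)
exists g, ((m@_g)^-1 *: pp q n0).
have cg : m@_g != 0 by rewrite mcoeff_neq0.
rewrite (linear_scale _ _ (KL_act_linearl m)).
suff -> : act (pp q n0) m = m@_g *: << g >> by rewrite scalerA mulVf ?scale1r.
rewrite KL_act_sum (bigD1_seq g) ?fset_uniq //.
rewrite big1_seq => [|h /andP[ne hm]]; last first.
  by apply: etrans _ (scaler0 _ m@_h); apply: congr1; exact: H.
exact: etrans (addr0 _) (congr1 (GRing.scale _) (iprefix_fix n0 eg)).
Qed.

Theorem KL_graded_simple : graded_simple (KL K x).
Proof.
split; first exact: KL_graded.
- exists (<< @LElt _ x (gpd_unit x) erefl >> : {malg K[Lset x]}).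
  by move/eqP; rewrite monalgU_eq0 oner_eq0.
move=> U [Us Ua Ud].
have [allz|/existsNP[m /not_implyP[Um mn0]]] := pselect (forall m, U m -> m = 0).
  by left.
right; have [s [F [Fd e]]] := Ud m Um.
(* Some homogeneous component of [m] is nonzero, and it lies in [U] because [U] is graded. *)
have [n Fn0] : exists n, F n <> 0.
  by apply/existsNP => Fz; apply: mn0; rewrite e big1.
have [UF dF] := Fd n.
have [g [a ea]] := KL_isolate dF Fn0.
by apply: (KL_sub_full (g := g) Us Ua); rewrite -ea; exact: Ua.
Qed.

End Infinite.

(** * Universal property of the balanced tensor product *)

Section TensorLift.
Variables (K : fieldType) (A B : gralgebra K).
Variables (M : grbimodule A B) (N : grmodule B) (V : lmodType K).

(** Unlike in [tensor_ext], the target is an arbitrary space [V]. *)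
Lemma tensor_lin_ext (f g : tensor_sp M N -> V) : linear f -> linear g ->
  (forall m n, f (tensor m n) = g (tensor m n)) -> f =1 g.
Proof.
move=> lf lg fg; elim/quot_ind => u; move: u.
apply: (linear_ext (linear_comp lf (to_quot_linear _)) (linear_comp lg (to_quot_linear _))).
by case=> m n; exact: fg.
Qed.

Variable f : M -> N -> V.
Hypotheses (fbil : bilin f).
Hypothesis fbal : forall m b n, f (bim_ract m b) n = f m (lm_act b n).

Definition tensor_pre_lift : {linear {malg K[(M * N)%type]} -> V} :=
  linext (fun p => f p.1 p.2).

Lemma tensor_pre_liftU m n : tensor_pre_lift << (m, n) >> = f m n.
Proof. exact: linextU. Qed.

Lemma tensor_pre_lift_rel u : spanOf (@tensor_rel _ _ _ M N) u -> tensor_pre_lift u = 0.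
Proof.
have [fl fr] := fbil.
elim=> [{}u []|| k y z _ Hy _ Hz].
- by move=> k m m' n; rewrite linearB linearP !tensor_pre_liftU fl subrr.
- by move=> k m n n'; rewrite linearB linearP !tensor_pre_liftU fr subrr.
- by move=> m b n; rewrite linearB !tensor_pre_liftU fbal subrr.
- exact: linear0.
- by rewrite linearP Hy Hz scaler0 addr0.
Qed.

Definition tensor_lift : tensor_sp M N -> V :=
  quot_lift (W := spanOf (@tensor_rel _ _ _ M N)) tensor_pre_lift.

Lemma tensor_lift_linear : linear tensor_lift.
Proof. exact/quot_lift_linear/tensor_pre_lift_rel. Qed.

Lemma tensor_liftE m n : tensor_lift (tensor m n) = f m n.
Proof.
by rewrite /tensor_lift /tensor quot_liftE ?tensor_pre_liftU //; exact: tensor_pre_lift_rel.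
Qed.

End TensorLift.

(** * The isomorphism $M\otimes_B B\cong M$ for $M=KL_x$ *)

Section IndRegular.
Variables (K : fieldType) (E : digraph) (x : bpath E).
Local Notation A := (isotropy_algebra K x).
Local Notation IndR := (Ind (regular_module A)).
Local Notation one := (<< iso_one x >> : {malg K[isotropy x]}).

(** The lift of the right action, which is balanced by its associativity [KL_ractA]. *)
Definition Ind_KL : IndR -> KL K x :=
  @tensor_lift _ _ _ (KL K x) (regular_module A) (KL K x) (@KL_ract K E x).

Lemma Ind_KL_linear : linear Ind_KL.
Proof.
exact: @tensor_lift_linear _ _ _ (KL K x) (regular_module A) (KL K x) _
  (@KL_ract_bilinear K E x) (@KL_ractA K E x).
Qed.

Lemma Ind_KLE m b : Ind_KL (@tensor _ _ _ (KL K x) (regular_module A) m b) = KL_ract m b.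
Proof.
exact: @tensor_liftE _ _ _ (KL K x) (regular_module A) (KL K x) _
  (@KL_ract_bilinear K E x) (@KL_ractA K E x) m b.
Qed.

Definition KL_Ind (m : KL K x) : IndR := @tensor _ _ _ (KL K x) (regular_module A) m one.

Lemma KL_Ind_linear : linear KL_Ind.
Proof. exact: tensor_linear_l. Qed.

Lemma sga_mulr1 (b : {malg K[isotropy x]}) : sga_mul b one = b.
Proof.
move: b; apply: (linear_ext (g := fun b => b)) => //.
  exact: (sga_mul_bilinear _ _).1.
by move=> g; rewrite sga_mulUU mulg1.
Qed.

Lemma KL_ract1 (m : {malg K[Lset x]}) : KL_ract m one = m.
Proof.
move: m; apply: (linear_ext (g := fun b => b)) => //.
  exact: (@KL_ract_bilinear K E x).1.
by move=> g; rewrite KL_ractUU; congr << _ >>; apply: Lset_eq; rewrite //= addr0.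
Qed.

(** Moving [b] across the tensor sign gives $mb\otimes 1=m\otimes b1=m\otimes b$. *)
Lemma Ind_KLK : cancel Ind_KL KL_Ind.
Proof.
have lc := linear_comp KL_Ind_linear Ind_KL_linear.
have li : linear (fun u : IndR => u) by [].
apply: (@tensor_lin_ext _ _ _ (KL K x) (regular_module A) _ _ _ lc li) => m b.
rewrite Ind_KLE /KL_Ind.
apply: etrans (@tensorC _ _ _ (KL K x) (regular_module A) m b one) _.
exact: congr1 (sga_mulr1 b).
Qed.

Lemma KL_IndK : cancel KL_Ind Ind_KL.
Proof. by move=> m; rewrite /KL_Ind Ind_KLE KL_ract1. Qed.

Lemma KL_ract_deg i j m (b : {malg K[isotropy x]}) :
  KL_deg i m -> @gra_deg _ A j b -> KL_deg (i + j) (KL_ract m b).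
Proof.
have [ll lr] := @KL_ract_bilinear K E x => hm hb.
apply: (lspan_preim (ll b) (@KL_deg_subspace K E x _) _ hm) => _ [g <- ->].
apply: (lspan_preim (lr _) (@KL_deg_subspace K E x _) _ hb) => _ [h <- ->].
by rewrite KL_ractUU; apply: span_gen; exists (L_mul g h).
Qed.

Theorem Ind_regular_iso : graded_isomorphic IndR (KL K x).
Proof.
apply: (graded_isomorphicI Ind_KL_linear Ind_KLK KL_IndK).
- move=> a; apply: (@tensor_lin_ext _ _ _ (KL K x) (regular_module A) (KL K x)) => [||m b].
  + exact: linear_comp Ind_KL_linear (tensor_act_linear a).
  + exact: linear_comp (KL_act_linear a) Ind_KL_linear.
  rewrite Ind_KLE.
  apply: etrans (congr1 Ind_KL (@tensor_actE _ _ _ (KL K x) (regular_module A) a m b)) _.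
  rewrite Ind_KLE.
  exact: esym (KL_actC a m b).
- move=> n u; apply: lspan_preim; first exact: Ind_KL_linear.
    exact: KL_deg_subspace.
  by move=> _ [i [j [m [b [hm hb <- ->]]]]]; rewrite Ind_KLE; exact: KL_ract_deg.
(* The unit [one] has degree 0, so tensoring with it keeps the degree [n]. *)
- move=> n m hm; apply: span_gen; exists n, 0, m, one; split=> //; last exact: addr0.
  by apply: span_gen; exists (iso_one x).
Qed.

End IndRegular.

(** * Products of paths and ghost paths in the Leavitt path algebra *)

Section Monomials.
Variables (K : fieldType) (E : digraph).

Local Notation "a ** b" := (nua_mul a b) (at level 40, left associativity).
Local Notation X g := (leavitt_word K ((g, [::]) : word E)).
Local Notation path_ := (@leavitt_path K E).
Local Notation ghost := (@leavitt_ghost K E).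
Local Notation mon := (@leavitt_mon K E).

(** A vertex that emits exactly one edge is not singular, and the sum in (CK2) at this vertex has a
    single term. *)
Lemma X_ck2_single (e : edge E) :
  (forall f, esrc f = esrc e -> f = e) -> X (GE e) ** X (GS e) = X (GV (esrc e)).
Proof.
move=> uniq_e; have out1 : out_edges (esrc e) = [set e]%classic.
  by apply/seteqP; split=> [f /uniq_e|f ->].
have nsing : ~ singular (esrc e).
  case=> [e0|]; first by have : out_edges (esrc e) e by []; rewrite e0.
  by rewrite out1; apply; exact: finite_set1.
rewrite leavitt_gen.
have := leavitt_rel_eq (leavitt_ck2 K nsing).
by rewrite out1 fsbig_set1 => <-.
Qed.

Opaque leavitt_nua leavitt_word.

Lemma path_cat v es es' (w : walk v (es ++ es')) (w1 : walk v es) (w2 : walk (walk_end v es) es') :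
  path_ (FinPath w) = path_ (FinPath w1) ** path_ (FinPath w2).
Proof.
elim: es v w w1 w2 => [|e es IH] v w w1 w2.
  rewrite fpath_nil path_nil X_path eqxx.
  by congr path_; exact: fpath_eq.
have w' : walk (erng e) (es ++ es') by have /andP[] := w.
have w1' : walk (erng e) es by have /andP[] := w1.
by rewrite (path_cons _ w w') (path_cons _ w1 w1') (IH _ w' w1' w2) nua_mulA.
Qed.

Lemma ghost_cat v es es' (w : walk v (es ++ es')) (w1 : walk v es) (w2 : walk (walk_end v es) es') :
  ghost (FinPath w) = ghost (FinPath w2) ** ghost (FinPath w1).
Proof.
elim: es v w w1 w2 => [|e es IH] v w w1 w2.
  rewrite (fpath_nil w1) ghost_nil (ghost_X _ (FinPath w2)).
  by congr ghost; exact: fpath_eq.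
have w' : walk (erng e) (es ++ es') by have /andP[] := w.
have w1' : walk (erng e) es by have /andP[] := w1.
by rewrite (ghost_cons _ w w') (ghost_cons _ w1 w1') (IH _ w' w1' w2) nua_mulA.
Qed.

Lemma path_fcat (mu nu : finpath E) (h : frng mu = fsrc nu) :
  path_ (fcat h) = path_ mu ** path_ nu.
Proof.
case: mu nu h => [v es w] [u es' w'] /= h; subst u.
exact: (@path_cat v es es' (@fcat_walk E (FinPath w) (FinPath w') erefl) w w').
Qed.

Lemma ghost_fcat (mu nu : finpath E) (h : frng mu = fsrc nu) :
  ghost (fcat h) = ghost nu ** ghost mu.
Proof.
case: mu nu h => [v es w] [u es' w'] /= h; subst u.
exact: (@ghost_cat v es es' (@fcat_walk E (FinPath w) (FinPath w') erefl) w w').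
Qed.

Lemma X_ghostl (nu : finpath E) : X (GV (frng nu)) ** ghost nu = ghost nu.
Proof.
case: nu => v es w; elim: es v w => [|e es IH] v w.
  by rewrite fpath_nil ghost_nil X_vw eqxx.
have w' : walk (erng e) es by have /andP[] := w.
by rewrite (ghost_cons _ w w') nua_mulA [_ ** ghost _]IH.
Qed.

Lemma mul_mid (A : nualgebra K) (a b b' d : A) :
  (a ** b) ** (b' ** d) = (a ** (b ** b')) ** d.
Proof. by rewrite !nua_mulA. Qed.

(* By (CK2) at each of its vertices, [ka ka^*] is the source of [ka]. *)
Lemma mon_fcat_diag (mu nu ka : finpath E) (hm : frng mu = fsrc ka) (hn : frng nu = fsrc ka) :
  (forall e, e \in fedges ka -> forall f, esrc f = esrc e -> f = e) ->
  mon (fcat hm) (fcat hn) = mon mu nu.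
Proof.
move=> sgl; have kk : path_ ka ** ghost ka = X (GV (fsrc ka)).
  case: ka {hm hn} sgl => v es w /=; elim: es v w => [|e es IH] v w sgl.
    by rewrite fpath_nil path_nil ghost_nil X_vw eqxx.
  have w' : walk (erng e) es by have /andP[] := w.
  have ev : esrc e = v by have /andP[/eqP] := w.
  rewrite (path_cons _ w w') (ghost_cons _ w w').
  rewrite mul_mid IH; last by move=> f fs; apply: sgl; rewrite inE fs orbT.
  rewrite X_er -ev; apply: X_ck2_single; apply: sgl; exact: mem_head.
rewrite /leavitt_mon path_fcat ghost_fcat mul_mid kk.
by rewrite -nua_mulA -hn X_ghostl.
Qed.

End Monomials.

(** * Comparison of $N_{vc}$ with $KL_{c^\infty}$ *)

Section CycleModule.
Variables (K : fieldType) (E : digraph) (v : vertex E) (c : finpath E).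
Hypotheses (hc : is_cycle c) (hv : fsrc c = v) (hx : without_exits c).

Local Notation x := (cycle_inf hc).
Local Notation act := (@lm_act K (leavitt K E) (KL_lmodule K x)).
Local Notation mon := (@leavitt_mon K E).

Definition unitL (y : bpath E) : Lset y := @LElt E y (gpd_unit y) erefl.
Local Notation g0 := (unitL x).
Local Notation cp := (IPath (cycle_edgeP hc)).

(** Any other edge with this source would be an exit. *)
Lemma cycle_edge_sole i f : esrc f = esrc (cycle_edge hc i) -> f = cycle_edge hc i.
Proof.
move=> ef; apply: contrapT => ne; apply: (hx (e := f)).
by exists (cycle_edge hc i); first exact: mem_tnth.
Qed.

Lemma cycle_inf_src : bsrc x = v.
Proof.
rewrite -hv /= /cycle_edge (tnth_nth (cycle_edge hc 0)) /= mod0n.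
exact: walk_nth0 _ (Defs.fpathP c) (cycle_pos hc).
Qed.

(** Each step is forced by [cycle_edge_sole]: a walk that starts on the cycle can only follow it. *)
Lemma cycle_walk es i : walk (esrc (cycle_edge hc i)) es ->
  es = [seq cycle_edge hc j | j <- iota i (size es)].
Proof.
elim: es i => //= e es IH i /andP[/eqP /cycle_edge_sole->].
by rewrite cycle_edgeP => /IH {1}->.
Qed.

Lemma cycle_path (nu : finpath E) : fsrc nu = v -> nu = iprefix cp (flen nu).
Proof.
move=> ev; have es : fsrc nu = esrc (cycle_edge hc 0) by rewrite ev -cycle_inf_src.
apply: fpath_eq => //=; apply: cycle_walk.
by rewrite -es; exact: Defs.fpathP.
Qed.

(** By [cycle_path] the path [nu] is a prefix of $c^\infty$, so $\mu\nu^*$ does not kill the unit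
    [g0]. *)
Lemma cycle_mon_ex (mu nu : finpath E) : frng mu = frng nu -> fsrc nu = v ->
  exists g, mon_rel mu nu g0 g.
Proof.
move=> emn /cycle_path; set n := flen nu => enu.
have [h e] := iprefix_cat cp n.
have hn : frng nu = bsrc (BInf (ishift cp n)) by rewrite enu.
apply: (@mon_rel_ex E x mu nu g0 _ (etrans emn hn) hn).
by rewrite [LHS]e; apply: bcat_eq.
Qed.

(** If [nu] is the shorter of the two ghost parts, then $\nu'=\nu\kappa$, and comparing lengths and
    paths gives $\mu'=\mu\kappa$. As $\kappa$ runs along the cycle, [mon_fcat_diag] cancels
    $\kappa\kappa^*$. *)
Lemma cycle_mon_inj (mu nu mu' nu' : finpath E) g :
  mon_rel mu nu g0 g -> mon_rel mu' nu' g0 g -> mon mu nu = mon mu' nu'.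
Proof.
wlog le : mu nu mu' nu' / (flen nu <= flen nu')%N => [W r r'|].
  by have [le|/ltnW le] := leqP (flen nu) (flen nu'); [exact: W|apply/esym; exact: W].
move=> [p [hm [hn [e1 e2 e3]]]] [p' [hm' [hn' [e1' e2' e3']]]].
have [ka [h [h' [enu' ep]]]] := bcat_prefix (etrans (esym e1) e1') le.
have hmk : frng mu = fsrc ka by rewrite hm -hn.
(* Both monomials take [g0], of degree 0, to [g], so $|\mu|-|\nu|=|\mu'|-|\nu'|$. *)
have elen : flen (fcat hmk) = flen mu'.
  apply/eqP; rewrite -eqz_nat flen_fcat PoszD.
  move: e3' => /=; rewrite e3 /= !addr0 enu' flen_fcat PoszD opprD addrA.
  by rewrite [RHS]addrAC => /addIr->; rewrite subrK.
have hmk' : frng (fcat hmk) = bsrc p' by rewrite frng_fcat.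
have emu' : mu' = fcat hmk.
  apply/esym; apply: (bcat_inj_path (hp := hmk') (hq := hm')) => //.
  by rewrite -e2' e2; subst p; rewrite (bcatA hmk' hm).
rewrite emu' enu' mon_fcat_diag // => e eka f.
(* The edges of [ka] belong to [nu'], a prefix of $c^\infty$, so each is the only edge at its
   source. *)
have ev : fsrc nu' = v by rewrite -(bsrc_bcat hn') -e1' cycle_inf_src.
have : e \in fedges nu' by rewrite enu' mem_cat eka orbT.
rewrite (cycle_path ev) => /mapP[j _ ->]; exact: cycle_edge_sole.
Qed.

(** Transitivity from [g0] supplies the monomial; it lies in $N_{vc}$ because the path of [g0]
    starts at [v]. *)
Lemma cycle_rep (g : Lset x) : exists mu nu,
  [/\ frng mu = frng nu, fsrc nu = v & mon_rel mu nu g0 g].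
Proof.
have [mu [nu r]] := mon_rel_trans_ex g0 g; exists mu, nu; split=> //.
  exact: mon_rel_rng r.
by have [<- _] := mon_rel_src r; exact: cycle_inf_src.
Qed.

(** Quantifying over all monomials that take [g0] to [g] makes the chosen preimage computable from
    any of them; [cycle_mon_inj] shows that they agree. *)
Lemma KL_Nvc_ex (g : Lset x) : exists m : subsp (Nvc_sub K v),
  forall mu nu, mon_rel mu nu g0 g -> val m = mon mu nu.
Proof.
have [mu [nu [e1 e2 r]]] := cycle_rep g.
have hm : Nvc_sub K v (mon mu nu) by apply: span_gen; exists mu, nu.
by exists (to_subsp hm) => mu' nu'; exact: cycle_mon_inj r.
Qed.

Definition KL_Nvc_gen (g : Lset x) : subsp (Nvc_sub K v) := projT1 (cid (KL_Nvc_ex g)).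

Lemma KL_Nvc_genE g mu nu : mon_rel mu nu g0 g -> val (KL_Nvc_gen g) = mon mu nu.
Proof. exact: projT2 (cid (KL_Nvc_ex g)) mu nu. Qed.

Definition Nvc_KL (m : Nvc K v) : KL K x := act (val (m : subsp (Nvc_sub K v))) << g0 >>.
Definition KL_Nvc (m : KL K x) : Nvc K v := linext KL_Nvc_gen m.

Lemma Nvc_KL_linear : linear Nvc_KL.
Proof.
move=> k a b; rewrite /Nvc_KL -[RHS](KL_act_linearl << g0 >>).
by congr (act _ _); rewrite linearP.
Qed.

Lemma KL_Nvc_linear : linear KL_Nvc.
Proof. exact: linext_linear. Qed.

Lemma KL_NvcK : cancel KL_Nvc Nvc_KL.
Proof.
have lc := linear_comp Nvc_KL_linear KL_Nvc_linear.
have li : linear (fun m : {malg K[Lset x]} => m) by [].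
apply: (linear_ext lc li) => g; rewrite /KL_Nvc linextU /Nvc_KL.
have [mu [nu [e1 e2 r]]] := cycle_rep g.
by rewrite (KL_Nvc_genE r); exact: KL_act_rel.
Qed.

Lemma Nvc_KLK : cancel Nvc_KL KL_Nvc.
Proof.
move=> m; apply: val_inj.
(* The composite is extended to all of $L_K(E)$, where the spanning set [Nvc_mon] lives, so that it
   can be compared with the identity on monomials. *)
have lv : linear (fun a : leavitt_nua K E =>
    val (linext KL_Nvc_gen (act a << g0 >>))).
  move=> k a b; rewrite (KL_act_linearl << g0 >>).
  by rewrite linext_linear linearP.
have li : linear (fun a : leavitt_nua K E => a) by [].
apply: (eq_on_lspan lv li _ (subspP (m : subsp (Nvc_sub K v)))).
move=> _ [mu [nu [e1 e2 ->]]].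
have [g r] := cycle_mon_ex e1 e2.
by rewrite (KL_act_rel _ r) linextU; exact: KL_Nvc_genE.
Qed.

Theorem Nvc_cycle_iso : graded_isomorphic (Nvc K v) (KL K x).
Proof.
apply: (graded_isomorphicI Nvc_KL_linear Nvc_KLK KL_NvcK).
- by move=> a m; rewrite /Nvc_KL lm_actA.
- move=> n m hm.
  apply: (lspan_preim (KL_act_linearl << g0 >>) (@KL_deg_subspace K E x n) _ hm).
  move=> _ [mu [nu [e1 e2 en ->]]]; have [g r] := cycle_mon_ex e1 e2.
  rewrite (KL_act_rel _ r); apply: span_gen; exists g => //.
  (* As [g0] has degree 0, the degree of [g] is that of the monomial. *)
  by have [p [hm' [hn [_ _ ->]]]] := r; rewrite en addr0.
- move=> n y hy.
  have lv : linear (fun y : {malg K[Lset x]} => val (linext KL_Nvc_gen y)).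
    by move=> k a b; rewrite linext_linear linearP.
  apply: (lspan_preim lv (span_subspace _) _ hy) => _ [g eg ->].
  have [mu [nu [e1 e2 r]]] := cycle_rep g.
  rewrite linextU (KL_Nvc_genE r); apply: span_gen; exists mu, nu; split=> //.
  by have [p [hm' [hn [_ _ e3]]]] := r; rewrite -eg e3 addr0.
Qed.

End CycleModule.

Theorem proposition4p22 (E : digraph) (K : fieldType) (v : vertex E)
    (c : finpath E) (hc : is_cycle c) (hv : fsrc c = v) (hx : without_exits c) :
  let x := cycle_inf hc in
  let IndN := Ind (regular_module (isotropy_algebra K x)) in
  let N := Nvc K v in
  [/\ graded_simple IndN, graded_simple N & graded_isomorphic IndN N].
Proof.
move=> x IndN N.
have indKL : graded_isomorphic IndN (KL K x) := @Ind_regular_iso K E x.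
have nKL : graded_isomorphic N (KL K x) := Nvc_cycle_iso K hc hv hx.
have simpleKL : graded_simple (KL K x) := @KL_graded_simple K E _.
split; [exact: graded_simple_iso indKL _ | exact: graded_simple_iso nKL _ |].
exact: graded_isomorphic_trans indKL (graded_isomorphic_sym nKL).
Qed.
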